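(* Let $\mathcal{H}$ be a complex Hilbert space, let $A, B$ be bounded self-adjoint operators on $\mathcal{H}$ and let $\nu$ be a real number. Suppose that either (i) $0 \leq \nu \leq 1/2$ and $0 < A \leq B$, or (ii) $1/2 \leq \nu \leq 1$ and $0 < B \leq A$. Then $$A\# B + \left( \nu - \frac{1}{2} \right)\left( B - A \right) \le A\#_\nu B \le \frac{1}{2}\left\{ (1 - \nu)A + \nu B \right\} + \frac{1}{2}\left\{ (1 - \nu)A^{-1} + \nu B^{-1} \right\}^{-1}.$$
   Context: All operators are bounded operators on a complex Hilbert space $\mathcal{H}$. A self-adjoint operator $A$ is positive ($A\ge 0$) if $\langle x, Ax\rangle \geq 0$ for all $x \in \mathcal{H}$. For self-adjoint $A,B$, $A \geq B$ means $A-B \geq 0$. The notation $A>0$ means that $A$ is an invertible positive operator. For invertible positive operators $A,B$ and $\nu \in [0,1]$, the weighted geometric mean is $A\#_{\nu}B = A^{1/2}(A^{-1/2}BA^{-1/2})^{\nu}A^{1/2}$, and $A\# B$ denotes $A\#_{1/2}B$. *)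

(* Defs.v *)
From HB Require Import structures.
From mathcomp Require Import all_boot all_order all_algebra.
From mathcomp Require Import complex.
From mathcomp Require Import all_classical all_reals all_analysis.

Set Implicit Arguments.
Unset Strict Implicit.
Unset Printing Implicit Defensive.

Import Order.TTheory GRing.Theory Num.Theory.
Import numFieldNormedType.Exports.

Local Open Scope classical_set_scope.
Local Open Scope ring_scope.
Local Open Scope complex_scope.

(* [hdot] is linear in its first argument and conjugate-linear in the second;
   no definition below depends on this choice. *)
HB.mixin Record CompleteNormedModule_isHilbert (R : realType) H
    of CompleteNormedModule R[i] H := {
  hdot : {dot H for Num.conj} ;
  hdot_normE : forall x : H, `|x| ^+ 2 = hdot x x
}.

#[short(type="hilbertType")]
HB.structure Definition Hilbert (R : realType) :=
  {H of CompleteNormedModule_isHilbert R H & CompleteNormedModule R[i] H}.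

Section Operators.
Context {R : realType} {H : hilbertType R}.
Implicit Types (A B S T : H -> H) (f : R -> R) (p : {poly R}) (nu : R).

Definition bounded_op A : Prop :=
  linear A /\ exists M : R, forall x, `|A x| <= M%:C * `|x|.

Definition self_adjoint A : Prop :=
  bounded_op A /\ forall x y, hdot (A x) y = hdot x (A y).

(* In [R[i]], [0 <= z] says that [z] is real and nonnegative. *)
Definition positive_op A : Prop :=
  self_adjoint A /\ forall x, 0 <= hdot x (A x).

Definition le_op A B : Prop :=
  [/\ self_adjoint A, self_adjoint B & positive_op (B - A)].

Definition is_inverse A B : Prop :=
  [/\ bounded_op B, A \o B = idfun & B \o A = idfun].

Definition invertible_op A : Prop := exists B, is_inverse A B.

(* The inverse of [A], and [0] if [A] is not invertible. *)
Definition inv_op A : H -> H := xget 0 [set B | is_inverse A B].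

Definition pos_invertible A : Prop := positive_op A /\ invertible_op A.

Definition spectrum A : set R[i] :=
  [set z | ~ invertible_op (A - z *: idfun)].

Definition op_norm A : R :=
  sup [set complex.Re `|A x| | x in [set x : H | `|x| <= 1]].

Definition horner_op p A : H -> H :=
  fun x => \sum_(i < size p) (p`_i)%:C *: iter i A x.

(* Continuous functional calculus of a self-adjoint operator, whose spectrum
   is contained in the real line: [S = f(A)] when [S] is the operator-norm
   limit of [p_n(A)] for real polynomials [p_n] that converge to [f] uniformly
   on the spectrum of [A]. *)
Definition is_cfc f A S : Prop :=
  bounded_op S /\
  exists p : nat -> {poly R},
    {uniform [set t : R | spectrum A t%:C],
       (fun n => horner (p n)) @ \oo --> f} /\
    op_norm (horner_op (p n) A - S) @[n --> \oo] --> (0 : R).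

(* [f(A)], and [0] if no such operator exists. It exists and is unique when [A]
   is self-adjoint and [f] is continuous on the spectrum of [A]. *)
Definition cfc f A : H -> H := xget 0 [set S | is_cfc f A S].

Definition pow_op A nu : H -> H := cfc (fun t => t `^ nu) A.

Definition gmean nu A B : H -> H :=
  pow_op A 2^-1 \o
    pow_op (pow_op A (- 2^-1) \o B \o pow_op A (- 2^-1)) nu \o
  pow_op A 2^-1.

End Operators.

(* Main.v *)
Require Import Defs.
From mathcomp Require Import all_boot all_order all_algebra.
From mathcomp Require Import complex ring lra.
From mathcomp Require Import all_classical all_reals all_analysis.

Import Order.TTheory GRing.Theory Num.Theory.
Import numFieldNormedType.Exports.

Set Implicit Arguments.
Unset Strict Implicit.
Unset Printing Implicit Defensive.

Local Open Scope ring_scope.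
Local Open Scope complex_scope.

(** Put C = A^(-1/2) B A^(-1/2).  The weighted mean is A^(1/2) C^nu A^(1/2), and
both bounds are of the form A^(1/2) g(C) A^(1/2) as well: A = A^(1/2) A^(1/2),
B = A^(1/2) C A^(1/2), and inverting
(1-nu) A^-1 + nu B^-1 = A^(-1/2) ((1-nu) + nu C^-1) A^(-1/2) turns the harmonic
mean into A^(1/2) ((1-nu) + nu C^-1)^-1 A^(1/2).  A congruence preserves the
order and the functional calculus of C is monotone, so only two inequalities
between real numbers remain, for t in the spectrum of C ([powR_lower] and
[powR_upper]):

  sqrt t + (nu - 1/2) (t - 1) <= t^nu
    <= ((1-nu) + nu t) / 2 + ((1-nu) + nu / t)^-1 / 2.

If A <= B then C >= 1, and if B <= A then 0 < C <= 1; these are the ranges of t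
in which the inequalities hold for nu <= 1/2 and for nu >= 1/2.

The functional calculus rests on the positivity of polynomials in a
self-adjoint A ([horner_op_ge0]): a self-adjoint T such that T - t
is invertible for every t < 0 is positive ([nonneg_of_resolvent]), and when p is
a real polynomial with p >= 0 on the spectrum and t < 0, the polynomial p - t
splits over the complex numbers into factors X - z with z outside the spectrum,
so that p(A) - t is a product of invertible operators.  Applied to e^2 - p^2,
this bounds the norm of p(A) by the supremum of |p| on the spectrum
([horner_op_norm_le]).  Hence limits of polynomials exist, are unique, and
inherit sums, products and order from the functions ([calcD], [calcM],
[calc_unique], [calc_le]).  Bernstein polynomials give the approximation of the
Lipschitz functions that occur ([lipschitz_poly_approx]).  Invertibility of
operators that are bounded below comes from the Lax-Milgram lemma, proved by a
contraction argument ([lax_milgram]). *)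

(** * The real inner product *)

Section RealInner.
Context {R : realType} {H : hilbertType R}.
Implicit Types (x y z : H) (a : R).

(** Quadratic forms of self-adjoint operators are real, so that the order can be
studied with real numbers only, where [lra] applies. *)
Definition rdot x y : R := complex.Re (hdot x y).
Definition rnorm x : R := complex.Re `|x|.

Lemma normE x : `|x| = (rnorm x)%:C.
Proof. by rewrite /rnorm RRe_real // normr_real. Qed.

Lemma hdotC x y : hdot x y = (hdot y x)^*.
Proof. by rewrite hermC /= expr0 mul1r. Qed.

Lemma rdotC x y : rdot x y = rdot y x.
Proof. by rewrite /rdot hdotC; case: (hdot y x). Qed.

Lemma rdotDl x y z : rdot (x + y) z = rdot x z + rdot y z.
Proof. by rewrite /rdot linearDl raddfD. Qed.

Lemma rdotDr x y z : rdot z (x + y) = rdot z x + rdot z y.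
Proof. by rewrite rdotC rdotDl ![rdot _ z]rdotC. Qed.

Lemma rdotZl a x y : rdot (a%:C *: x) y = a * rdot x y.
Proof.
by rewrite /rdot linearZl_LR /=; case: (hdot x y) => u v /=; rewrite mul0r subr0.
Qed.

Lemma rdotZr a x y : rdot x (a%:C *: y) = a * rdot x y.
Proof. by rewrite rdotC rdotZl rdotC. Qed.

Lemma rdotNl x y : rdot (- x) y = - rdot x y.
Proof. by rewrite -scaleN1r -(rmorphN1 (real_complex R)) rdotZl mulN1r. Qed.

Lemma rdotNr x y : rdot x (- y) = - rdot x y.
Proof. by rewrite rdotC rdotNl rdotC. Qed.

Lemma rdotBl x y z : rdot (x - y) z = rdot x z - rdot y z.
Proof. by rewrite rdotDl rdotNl. Qed.

Lemma rdotBr x y z : rdot z (x - y) = rdot z x - rdot z y.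
Proof. by rewrite rdotDr rdotNr. Qed.

Lemma rdot0l x : rdot 0 x = 0.
Proof. by rewrite -(subrr x) rdotBl subrr. Qed.

Lemma rdotxx x : rdot x x = rnorm x ^+ 2.
Proof.
by rewrite /rdot -hdot_normE normE -rmorphXn.
Qed.

Lemma rnorm_ge0 x : 0 <= rnorm x.
Proof. by rewrite -lecR -normE normr_ge0. Qed.

Lemma rnormD x y : rnorm (x + y) <= rnorm x + rnorm y.
Proof. by rewrite -lecR rmorphD /= -!normE ler_normD. Qed.

Lemma rnormZC (k : R[i]) x : rnorm (k *: x) = complex.Re `|k| * rnorm x.
Proof.
apply: (@complexI R); rewrite -normE normrZ normE rmorphM; congr (_ * _).
Qed.

Lemma Re_norm_ge0 (k : R[i]) : 0 <= complex.Re `|k|.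
Proof. by have := normr_ge0 k; rewrite lecE => /andP[]. Qed.

Lemma rnormZ a x : rnorm (a%:C *: x) = `|a| * rnorm x.
Proof.
rewrite rnormZC; congr (_ * _).
by rewrite normc_def /= expr0n /= addr0 sqrtr_sqr.
Qed.

Lemma rnormN x : rnorm (- x) = rnorm x.
Proof. by rewrite /rnorm normrN. Qed.

Lemma rnormB x y : rnorm (x - y) = rnorm (y - x).
Proof. by rewrite -rnormN opprB. Qed.

Lemma rnorm0 : rnorm (0 : H) = 0.
Proof. by rewrite /rnorm normr0. Qed.

Lemma rnorm0_eq0 x : rnorm x = 0 -> x = 0.
Proof. by move=> x0; apply: normr0_eq0; rewrite normE x0. Qed.

Lemma rnorm_triangle x y z : rnorm (x - z) <= rnorm (x - y) + rnorm (y - z).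
Proof.
by apply: le_trans (rnormD _ _); rewrite addrA subrK.
Qed.

(** Expanding the square of the triangle inequality gives Cauchy-Schwarz. *)
Lemma rdot_le x y : rdot x y <= rnorm x * rnorm y.
Proof.
have := rnormD x y.
rewrite -(ler_pXn2r (n := 2)) ?nnegrE ?addr_ge0 ?rnorm_ge0 //.
rewrite -rdotxx rdotDl !rdotDr !rdotxx (rdotC y x); lra.
Qed.

Lemma rdot_ge x y : - (rnorm x * rnorm y) <= rdot x y.
Proof.
by have := rdot_le (- x) y; rewrite rnormN rdotNl lerNl.
Qed.

(** Multiplying the first argument by the imaginary unit exposes the imaginary
part of [hdot] as a real part. *)
Lemma hdot_eq (u v x y : H) :
  (forall a : R[i], rdot (a *: u) v = rdot (a *: x) y) -> hdot u v = hdot x y.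
Proof.
move=> e; have /(congr1 (real_complex R)) := e 1.
have /(congr1 (real_complex R)) := e 'i%C.
rewrite /rdot !linearZl_LR /= => e1 e2.
move: e1 e2; case: (hdot u v) => a b; case: (hdot x y) => c d /=.
rewrite !mul0r !mul1r !sub0r !subr0 => -[e1] [e2].
by move/oppr_inj: e1 => ->; rewrite e2.
Qed.

Lemma rnorm_complete (u : nat -> H) :
  (forall e : R, 0 < e -> exists n, forall k, rnorm (u (n + k)%N - u n) <= e) ->
  exists l, forall e : R, 0 < e ->
    exists n, forall k, (n <= k)%N -> rnorm (u k - l) <= e.
Proof.
move=> cu.
have gtRe (e : R[i]) : 0 < e -> 0 < complex.Re e /\ e = (complex.Re e)%:C.
  by case: e => a b; rewrite ltcE /= => /andP[/eqP -> ->].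
have cvu : cvgn u.
  apply/cauchy_cvgP/cauchy_exP => e /gtRe[e0 ->].
  have /cu[n un] : 0 < complex.Re e / 2 by rewrite divr_gt0.
  exists (u n).
  exists n => // k /= nk; rewrite -ball_normE /ball_ /= distrC normE ltcR.
  have := un (k - n)%N; rewrite subnKC // => /le_lt_trans; apply.
  lra.
exists (limn u) => e e0.
have /cvgrPdist_le := cvu.
move=> /(_ e%:C); rewrite ltcR => /(_ e0) [n _ un].
exists n => k nk; have := un k nk.
by rewrite /= normE lecR rnormB.
Qed.

End RealInner.

(** * Bounded and self-adjoint operators *)

Section Operators.
Context {R : realType} {H : hilbertType R}.
Implicit Types (A B S T : H -> H) (x y : H) (a c M : R).

Lemma bounded_opP A : bounded_op A ->
  exists2 M, 0 < M & forall x, rnorm (A x) <= M * rnorm x.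
Proof.
move=> [_ [M AM]]; exists (Num.max M 1); first by rewrite lt_max ltr01 orbT.
move=> x; have := AM x; rewrite !normE -rmorphM lecR => /le_trans; apply.
by rewrite ler_wpM2r ?rnorm_ge0 // le_max lexx.
Qed.

Lemma bounded_opI A M : linear A -> (forall x, rnorm (A x) <= M * rnorm x) ->
  bounded_op A.
Proof.
by move=> lA AM; split=> //; exists M => x; rewrite !normE -rmorphM lecR.
Qed.

Section Linearity.
Context (A : H -> H) (bA : bounded_op A).
Lemma opD x y : A (x + y) = A x + A y.
Proof. by have := bA.1 1 x y; rewrite !scale1r. Qed.
Lemma op0 : A 0 = 0.
Proof. by apply: (addIr (A 0)); rewrite -opD !add0r. Qed.
Lemma opZ (a : R[i]) x : A (a *: x) = a *: A x.
Proof. by have := bA.1 a x 0; rewrite op0 !addr0. Qed.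
Lemma opN x : A (- x) = - A x.
Proof. by rewrite -scaleN1r opZ scaleN1r. Qed.
Lemma opB x y : A (x - y) = A x - A y.
Proof. by rewrite opD opN. Qed.
End Linearity.

Lemma bounded_id : bounded_op (idfun : H -> H).
Proof. by apply: (@bounded_opI _ 1) => // x; rewrite mul1r. Qed.

Lemma bounded_add A B : bounded_op A -> bounded_op B -> bounded_op (A + B).
Proof.
move=> bA bB; have [M M0 AM] := bounded_opP bA; have [K K0 BK] := bounded_opP bB.
apply: (@bounded_opI _ (M + K)) => [a x y|x].
  by rewrite !fctE !(opD bA, opD bB, opZ bA, opZ bB) scalerDr addrACA.
by rewrite mulrDl; apply: le_trans (rnormD _ _) _; rewrite lerD.
Qed.

Lemma scaleopE (a : R[i]) A x : (a *: A) x = a *: A x.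
Proof. by []. Qed.

Lemma bounded_scale (a : R[i]) A : bounded_op A -> bounded_op (a *: A).
Proof.
move=> bA; have [M M0 AM] := bounded_opP bA.
apply: (@bounded_opI _ (complex.Re `|a| * M)) => [b x y|x].
  rewrite !scaleopE !(opD bA, opZ bA) scalerDr !scalerA; congr (_ + _).
  by rewrite mulrC.
by rewrite scaleopE rnormZC -mulrA ler_wpM2l ?Re_norm_ge0.
Qed.

Lemma bounded_opp A : bounded_op A -> bounded_op (- A).
Proof. by move=> bA; rewrite -scaleN1r; exact: bounded_scale. Qed.

Lemma bounded_sub A B : bounded_op A -> bounded_op B -> bounded_op (A - B).
Proof. by move=> bA bB; apply: bounded_add => //; exact: bounded_opp. Qed.

Lemma bounded_comp A B : bounded_op A -> bounded_op B -> bounded_op (A \o B).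
Proof.
move=> bA bB; have [M M0 AM] := bounded_opP bA; have [K K0 BK] := bounded_opP bB.
apply: (@bounded_opI _ (M * K)) => [a x y|x].
  by rewrite /= !(opD bA, opD bB, opZ bA, opZ bB).
by apply: le_trans (AM _) _; rewrite -mulrA ler_wpM2l // ltW.
Qed.

Lemma self_adjoint_rdot A x y : self_adjoint A -> rdot (A x) y = rdot x (A y).
Proof. by move=> [_ sA]; rewrite /rdot sA. Qed.

(** Complex linearity upgrades the symmetry of the real form to that of [hdot]. *)
Lemma self_adjointI A : bounded_op A ->
  (forall x y, rdot (A x) y = rdot x (A y)) -> self_adjoint A.
Proof.
move=> bA sA; split=> // x y; apply: hdot_eq => a.
by rewrite -(opZ bA) sA.
Qed.

(** For a self-adjoint operator the value of [hdot x (A x)] equals its own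
conjugate, hence its real part decides positivity. *)
Lemma positive_opE A : positive_op A <->
  self_adjoint A /\ forall x, 0 <= rdot x (A x).
Proof.
split=> -[sA pA]; split=> // x.
  by have := pA x; rewrite /rdot lecE /= => /andP[_].
rewrite lecE /= pA andbT; apply/eqP => /=.
have := hdotC x (A x); rewrite sA.2.
by case: (hdot x (A x)) => u v [] /= vN; lra.
Qed.

Lemma self_adjoint_id : self_adjoint (idfun : H -> H).
Proof. by split=> //; exact: bounded_id. Qed.

Lemma self_adjoint_add A B :
  self_adjoint A -> self_adjoint B -> self_adjoint (A + B).
Proof.
move=> sA sB; apply: self_adjointI; first exact: bounded_add sA.1 sB.1.
by move=> x y; rewrite !fctE rdotDl rdotDr !self_adjoint_rdot.
Qed.

Lemma self_adjoint_scale a A : self_adjoint A -> self_adjoint (a%:C *: A).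
Proof.
move=> sA; apply: self_adjointI; first exact: bounded_scale sA.1.
by move=> x y; rewrite !scaleopE rdotZl rdotZr self_adjoint_rdot.
Qed.

Lemma self_adjoint_opp A : self_adjoint A -> self_adjoint (- A).
Proof.
by move=> sA; rewrite -scaleN1r -(rmorphN1 (real_complex R)); exact: self_adjoint_scale.
Qed.

Lemma self_adjoint_sub A B :
  self_adjoint A -> self_adjoint B -> self_adjoint (A - B).
Proof. by move=> sA sB; apply: self_adjoint_add => //; exact: self_adjoint_opp. Qed.

Lemma self_adjoint_congr A S :
  self_adjoint A -> self_adjoint S -> self_adjoint (S \o A \o S).
Proof.
move=> sA sS; apply: self_adjointI.
  exact: bounded_comp (bounded_comp sS.1 sA.1) sS.1.
by move=> x y; rewrite /= !self_adjoint_rdot.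
Qed.

Lemma le_opE A B : le_op A B <->
  [/\ self_adjoint A, self_adjoint B & forall x, rdot x (A x) <= rdot x (B x)].
Proof.
split=> -[sA sB].
  move=> /positive_opE[_ AB]; split=> // x.
  by have := AB x; rewrite !fctE rdotBr subr_ge0.
move=> AB; split=> //; apply/positive_opE; split; first exact: self_adjoint_sub.
by move=> x; rewrite !fctE rdotBr subr_ge0.
Qed.

End Operators.

(** * Invertibility, positivity and the real spectrum *)

Section Spectral.
Context {R : realType} {H : hilbertType R}.
Implicit Types (A B S T : H -> H) (x y : H) (a c M t : R).

Lemma rnorm_small x : (forall e : R, 0 < e -> rnorm x <= e) -> x = 0.
Proof.
move=> xe; apply: rnorm0_eq0; apply/eqP; rewrite eq_le rnorm_ge0 andbT.
by apply/ler_addgt0Pr => e /xe; rewrite add0r.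
Qed.

Lemma bounded_below_invertible T c : bounded_op T -> 0 < c ->
  (forall x, c * rnorm x <= rnorm (T x)) -> (forall y, exists x, T x = y) ->
  invertible_op T.
Proof.
move=> bT c0 cT surj.
have injT x y : T x = T y -> x = y.
  move=> Txy; apply/eqP; rewrite -subr_eq0; apply/eqP/rnorm0_eq0/eqP.
  rewrite eq_le rnorm_ge0 andbT -(pmulr_rle0 _ c0).
  by apply: le_trans (cT _) _; rewrite (opB bT) Txy subrr rnorm0.
have [B TB] := choice surj.
have BT x : B (T x) = x by apply: injT; rewrite TB.
exists B; split; [|exact/funext|exact/funext].
apply: (@bounded_opI _ _ _ c^-1) => [a x y|x].
  by apply: injT; rewrite (opD bT) (opZ bT) !TB.
by rewrite ler_pdivlMl // -{2}(TB x).
Qed.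

Lemma contraction_fixpoint (g : H -> H) (q : R) : 0 <= q < 1 ->
  (forall x y, rnorm (g x - g y) <= q * rnorm (x - y)) -> exists x, g x = x.
Proof.
move=> /andP[q0 q1] gq; pose u n := iter n g 0; pose K := rnorm (u 1%N - u 0%N).
have q1' : 0 < 1 - q by rewrite subr_gt0.
have K0 : 0 <= K by exact: rnorm_ge0.
(* the displacement of every iterate is at most the sum of the geometric series *)
have u0 k : rnorm (u k - u 0%N) <= K / (1 - q).
  elim: k => [|k IHk]; first by rewrite subrr rnorm0 divr_ge0 // ltW.
  apply: le_trans (rnorm_triangle _ (u 1%N) _) _; rewrite -/K.
  have := gq (u k) (u 0%N); rewrite -[g (u k)]/(u k.+1) -[g (u 0%N)]/(u 1%N).
  have : q * rnorm (u k - u 0%N) <= q * (K / (1 - q)) by rewrite ler_wpM2l.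
  have : q * (K / (1 - q)) + K = K / (1 - q) by field; rewrite gt_eqF.
  lra.
have un n k : rnorm (u (n + k)%N - u n) <= q ^+ n * (K / (1 - q)).
  elim: n => [|n IHn]; first by rewrite expr0 mul1r add0n.
  by apply: le_trans (gq _ _) _; rewrite exprS -mulrA ler_wpM2l.
have cq (e : R) : 0 < e -> exists n, q ^+ n * (K / (1 - q)) <= e.
  move=> e0.
  (* the summand 1 keeps the divisor positive when K = 0 *)
  have /cvgrPdist_le /(_ (e / (1 + K / (1 - q)))) :
      (q ^+ n @[n --> \oo] --> (0 : R))%classic.
    by apply: cvg_expr; rewrite ger0_norm.
  have K1 : 0 < 1 + K / (1 - q) by rewrite ltr_wpDr // divr_ge0 // ltW.
  case; first by rewrite divr_gt0.
  move=> n _ /(_ n (leqnn n)) /=; rewrite sub0r normrN ger0_norm ?exprn_ge0 //.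
  rewrite ler_pdivlMr // => qn; exists n; apply: le_trans qn.
  by rewrite ler_wpM2l ?exprn_ge0 // lerDr.
have [|l ul] := rnorm_complete (u := u).
  by move=> e /cq[n qn]; exists n => k; apply: le_trans (un _ _) qn.
exists l; apply/eqP; rewrite -subr_eq0; apply/eqP/rnorm_small => e e0.
have /ul[n uln] : 0 < e / 2 by rewrite divr_gt0.
have := uln n (leqnn n); have := uln n.+1 (leqnSn n).
have := gq l (u n); rewrite -[g (u n)]/(u n.+1) [X in q * X]rnormB.
have := rnorm_triangle (g l) (u n.+1) l.
have : q * rnorm (u n - l) <= rnorm (u n - l).
  by rewrite ler_piMl ?rnorm_ge0 // ltW.
lra.
Qed.

(** Solving T x = y means finding a fixed point of x - d (T x - y).  If the form of
T is at least c and the norm of T at most M, the square of the norm of 1 - d T is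
at most 1 - 2 c d + M^2 d^2, which is smallest, namely 1 - (c / M)^2, for
d = c / M^2. *)
Lemma lax_milgram T c : bounded_op T -> 0 < c ->
  (forall x, c * rnorm x ^+ 2 <= rdot x (T x)) -> invertible_op T.
Proof.
move=> bT c0 cT; apply: (bounded_below_invertible bT c0) => [x|y].
  have [->|x0] := eqVneq (rnorm x) 0; first by rewrite mulr0 rnorm_ge0.
  have xp : 0 < rnorm x by rewrite lt_neqAle eq_sym x0 rnorm_ge0.
  rewrite -(ler_pM2l xp); apply: le_trans (rdot_le _ _).
  by apply: le_trans (cT x); rewrite expr2 mulrCA.
have [K K0 TK] := bounded_opP bT.
(* M >= c makes the contraction factor nonnegative *)
pose M := Num.max K c.
have M0 : 0 < M by rewrite lt_max K0.
have cM : c <= M by rewrite le_max lexx orbT.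
have TM x : rnorm (T x) ^+ 2 <= M ^+ 2 * rnorm x ^+ 2.
  rewrite -exprMn ler_pXn2r ?nnegrE ?rnorm_ge0 ?mulr_ge0 ?rnorm_ge0 ?(ltW M0) //.
  by apply: le_trans (TK x) _; rewrite ler_wpM2r ?rnorm_ge0 // le_max lexx.
pose r := c / M; have r0 : 0 < r by rewrite divr_gt0.
have r1 : r <= 1 by rewrite ler_pdivrMr // mul1r.
have r2 : r ^+ 2 <= 1 by rewrite expr_le1 // ltW.
have r20 : 0 < r ^+ 2 by rewrite exprn_gt0.
(* 1 - r^2 / 2 is a rational upper bound of the square root of 1 - r^2 *)
have [||x gx] := contraction_fixpoint
  (g := fun x => x - (c / M ^+ 2)%:C *: (T x - y)) (q := 1 - r ^+ 2 / 2).
- by apply/andP; split; lra.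
- move=> x1 x2; set z := x1 - x2.
  have -> : x1 - (c / M ^+ 2)%:C *: (T x1 - y) - (x2 - (c / M ^+ 2)%:C *: (T x2 - y))
     = z - (c / M ^+ 2)%:C *: T z.
    by rewrite opprD addrACA -opprD -scalerBr opprB [_ + (y - _)]addrA subrK -(opB bT).
  clearbody z.
  rewrite -(@ler_pXn2r _ 2) ?nnegrE ?rnorm_ge0 ?mulr_ge0 ?rnorm_ge0 //; last by lra.
  rewrite exprMn -[leLHS]rdotxx rdotBl !rdotBr !rdotZl !rdotZr !rdotxx.
  rewrite (rdotC (T z)).
  have e1 : c / M ^+ 2 * (c * rnorm z ^+ 2) = r ^+ 2 * rnorm z ^+ 2.
    by rewrite /r; field; rewrite gt_eqF.
  have e2 : c / M ^+ 2 * (c / M ^+ 2 * (M ^+ 2 * rnorm z ^+ 2)) = r ^+ 2 * rnorm z ^+ 2.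
    by rewrite /r; field; rewrite gt_eqF.
  have d0 : 0 <= c / M ^+ 2 by rewrite divr_ge0 ?exprn_ge0 // ltW.
  have := ler_wpM2l d0 (cT z); rewrite e1.
  have := ler_wpM2l d0 (ler_wpM2l d0 (TM z)); rewrite e2.
  have : 0 <= (r ^+ 2 / 2) ^+ 2 * rnorm z ^+ 2 by rewrite mulr_ge0 // exprn_even_ge0.
  lra.
exists x; apply/eqP; rewrite -subr_eq0.
have /eqP : (c / M ^+ 2)%:C *: (T x - y) = 0.
  by apply: (addrI x); rewrite addr0 -{1}gx subrK.
rewrite scaler_eq0 => /orP[|//].
have e : c / M ^+ 2 != 0 by rewrite gt_eqF // divr_gt0 // exprn_gt0.
by rewrite -(rmorph0 (real_complex R)) (inj_eq (@complexI _)) (negPf e).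
Qed.

(** T (S T)^-1 is a right inverse of S, and (S T)^-1 T a left inverse by
commutation. *)
Lemma invertible_factor S T : bounded_op S -> bounded_op T ->
  S \o T = T \o S -> invertible_op (S \o T) -> invertible_op S.
Proof.
move=> bS bT ST [B [bB STB BST]].
have e1 x : S (T (B x)) = x by have /(congr1 (@^~ x)) := STB.
have e2 x : B (S (T x)) = x by have /(congr1 (@^~ x)) := BST.
have e3 x : S (T x) = T (S x) by have /(congr1 (@^~ x)) := ST.
have BT x : B (T x) = T (B x) by rewrite -{1}(e1 x) -e3 e2.
exists (T \o B); split; first exact: bounded_comp.
  by apply/funext => x; rewrite /= e1.
by apply/funext => x; rewrite /= -BT -e3 e2.
Qed.

Lemma invertible_comp S T : invertible_op S -> invertible_op T ->
  invertible_op (S \o T).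
Proof.
move=> [B [bB SB BS]] [D [bD TD DT]]; exists (D \o B).
split; first exact: bounded_comp.
  rewrite (_ : _ \o _ = S \o (T \o D) \o B) //; rewrite TD; exact: SB.
rewrite (_ : _ \o _ = D \o (B \o S) \o T) //; by rewrite BS; exact: DT.
Qed.

(** Both S (M - S) S and (M - S) S (M - S) are positive, and their sum is
M (M S - S^2). *)
Lemma positive_sqr_le S M : self_adjoint S -> (forall x, 0 <= rdot x (S x)) ->
  0 < M -> (forall x, rdot x (S x) <= M * rnorm x ^+ 2) ->
  forall x, rnorm (S x) ^+ 2 <= M * rdot x (S x).
Proof.
move=> sS S0 M0 SM x; rewrite -(ler_pM2l M0).
have := SM (S x); rewrite -rdotxx => h1.
have := S0 (M%:C *: x - S x).
rewrite (opB sS.1) (opZ sS.1) rdotBl !rdotBr !rdotZl !rdotZr.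
rewrite -[rdot x (S (S x))]self_adjoint_rdot //; lra.
Qed.

(** An inverse of norm K bounds the norm of S x below by that of x over K, and
[positive_sqr_le] carries this over to the form of S. *)
Lemma coercive_of_invertible S : self_adjoint S ->
  (forall x, 0 <= rdot x (S x)) -> invertible_op S ->
  exists2 c, 0 < c & forall x, c * rnorm x ^+ 2 <= rdot x (S x).
Proof.
move=> sS S0 [B [bB SB BS]].
have [M M0 SM] := bounded_opP sS.1; have [K K0 BK] := bounded_opP bB.
have KM : 0 < K ^+ 2 * M by rewrite mulr_gt0 // exprn_gt0.
exists (K ^+ 2 * M)^-1; first by rewrite invr_gt0.
move=> x; rewrite ler_pdivrMl // -mulrA.
have SM2 z : rdot z (S z) <= M * rnorm z ^+ 2.
  by apply: le_trans (rdot_le _ _) _; rewrite expr2 mulrCA ler_wpM2l ?rnorm_ge0.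
apply: le_trans (ler_wpM2l (exprn_ge0 2 (ltW K0)) (positive_sqr_le sS S0 M0 SM2 x)).
rewrite -exprMn ler_pXn2r ?nnegrE ?mulr_ge0 ?rnorm_ge0 // ?(ltW K0) //.
by have /(congr1 (@^~ x)) /= {1}<- := BS; exact: BK.
Qed.

(** Let m be the greatest lower bound of the quadratic form.  If m < 0, then T - m
is positive and invertible, hence bounded below by some d > 0, so that m + d is
also a lower bound. *)
Lemma nonneg_of_resolvent T : self_adjoint T ->
  (forall t, t < 0 -> invertible_op (T - t%:C *: idfun)) ->
  forall x, 0 <= rdot x (T x).
Proof.
move=> sT iT x0; rewrite leNgt; apply/negP => x0n.
pose E := [set l : R | forall x, l * rnorm x ^+ 2 <= rdot x (T x)]%classic.
have [M M0 TM] := bounded_opP sT.1.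
have x0p : 0 < rnorm x0 ^+ 2.
  rewrite exprn_gt0 // lt_neqAle rnorm_ge0 andbT eq_sym; apply/eqP.
  by move/rnorm0_eq0 => x00; move: x0n; rewrite x00 rdot0l ltxx.
have E0 : (E !=set0)%classic.
  exists (- M) => x; apply: le_trans (rdot_ge _ _).
  by rewrite mulNr lerN2 expr2 mulrCA ler_wpM2l ?rnorm_ge0.
have Eub l : E l -> l < 0.
  by move=> /(_ x0) /le_lt_trans/(_ x0n); rewrite pmulr_llt0.
have supE : has_sup E by split=> //; exists 0 => l /Eub/ltW.
have Em : E (sup E).
  move=> x; have [/eqP|x1] := eqVneq (rnorm x ^+ 2) 0.
    by rewrite sqrf_eq0 => /eqP/rnorm0_eq0 ->; rewrite rdot0l rnorm0 expr0n mulr0.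
  have x1p : 0 < rnorm x ^+ 2 by rewrite lt_neqAle eq_sym x1 exprn_ge0 ?rnorm_ge0.
  rewrite -ler_pdivlMr //; apply: ge_sup => // l /(_ x).
  by rewrite ler_pdivlMr.
have m0 := Eub _ Em; set m := sup E in Em m0 supE.
have Tm x : rdot x ((T - m%:C *: idfun) x) = rdot x (T x) - m * rnorm x ^+ 2.
  by rewrite rdotBr rdotZr rdotxx.
have [||d d0 Td] := coercive_of_invertible _ _ (iT m m0).
- by apply: self_adjoint_sub => //; apply: self_adjoint_scale; exact: self_adjoint_id.
- by move=> x; rewrite Tm subr_ge0; exact: Em.
have : E (m + d) by move=> x; have := Td x; rewrite Tm mulrDl lerBrDl.
by move=> /(ub_le_sup supE.2); rewrite gerDl leNgt d0.
Qed.

(** (A - z) (A - conj z) = (A - Re z)^2 + (Im z)^2 is bounded below by (Im z)^2. *)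
Lemma spectrum_real A (z : R[i]) : self_adjoint A -> spectrum A z -> complex.Im z = 0.
Proof.
move=> sA Az; apply/eqP/negP => /negP b0; apply: Az.
case: z b0 => a b /= b0.
have bI (w : R[i]) : bounded_op (w *: (idfun : H -> H)).
  by apply: bounded_scale; exact: bounded_id.
have Ez : a +i* b = a%:C + (b *i).
  by apply/eqP; rewrite eq_complex /= addr0 add0r !eqxx.
have bT (w : R[i]) : bounded_op (A - w *: idfun) by apply: bounded_sub sA.1 (bI _).
pose zb := a%:C - b *i.
have comm w1 w2 x : (A - w1 *: idfun) ((A - w2 *: idfun) x)
    = A (A x) - (w1 + w2) *: A x + (w1 * w2) *: x.
  rewrite !fctE /= (opB sA.1) (opZ sA.1) scalerBr scalerA opprB addrA.
  by rewrite scalerDl opprD addrAC [in RHS]addrA; congr (_ + _); rewrite addrAC.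
rewrite Ez; apply: (@invertible_factor _ (A - zb *: idfun)) => //.
  by apply/funext => x; rewrite /= !comm (addrC zb) (mulrC zb).
apply: (@lax_milgram _ (b ^+ 2)).
- exact: bounded_comp.
- by rewrite lt_neqAle eq_sym sqrf_eq0 b0 sqr_ge0.
move=> x; rewrite /= comm.
have -> : (a%:C + b *i + zb) = (2 * a)%:C.
  by apply/eqP; rewrite eq_complex /=; apply/andP; split; apply/eqP; ring.
have -> : (a%:C + b *i) * zb = (a ^+ 2 + b ^+ 2)%:C.
  by apply/eqP; rewrite eq_complex /=; apply/andP; split; apply/eqP; ring.
have := sqr_ge0 (rnorm (A x - a%:C *: x)).
rewrite -[X in 0 <= X -> _]rdotxx rdotBl !rdotBr rdotDr !rdotZl !rdotZr !rdotxx.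
rewrite rdotBr rdotZr -[rdot x (A (A x))]self_adjoint_rdot // rdotxx (rdotC (A x)). lra.
Qed.

End Spectral.

(** * Polynomials in a self-adjoint operator *)

Section PolyCalculus.
Context {R : realType} {H : hilbertType R}.
Implicit Types (A B S T : H -> H) (x y : H) (a c M t : R).
Implicit Types (p : {poly R}) (q : {poly R[i]}).

(** Complex coefficients are needed to split a real polynomial into linear
factors. *)
Definition chorner_op q A : H -> H := fun x => \sum_(i < size q) q`_i *: iter i A x.

Lemma chorner_op_wide n q A x : (size q <= n)%N ->
  chorner_op q A x = \sum_(i < n) q`_i *: iter i A x.
Proof.
move=> qn; rewrite /chorner_op (big_ord_widen n (fun i => q`_i *: iter i A x) qn).
rewrite big_mkcond; apply: eq_bigr => i _; case: ltnP => // qi.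
by rewrite nth_default // scale0r.
Qed.

Lemma chorner_opD q r A x :
  chorner_op (q + r) A x = chorner_op q A x + chorner_op r A x.
Proof.
pose n := maxn (size q) (size r).
rewrite (@chorner_op_wide n) ?size_polyD // (@chorner_op_wide n q) ?leq_maxl //.
rewrite (@chorner_op_wide n r) ?leq_maxr // -big_split; apply: eq_bigr => i _.
by rewrite coefD scalerDl.
Qed.

Lemma chorner_opZ (a : R[i]) q A x : chorner_op (a *: q) A x = a *: chorner_op q A x.
Proof.
rewrite (@chorner_op_wide (size q)) ?size_scale_leq // scaler_sumr.
by apply: eq_bigr => i _; rewrite coefZ scalerA.
Qed.

Lemma chorner_opC (a : R[i]) A x : chorner_op a%:P A x = a *: x.
Proof.
by rewrite (@chorner_op_wide 1) ?size_polyC_leq1 // big_ord1 coefC.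
Qed.

Lemma chorner_opMX q A x : chorner_op (q * 'X) A x = chorner_op q A (A x).
Proof.
rewrite (@chorner_op_wide (size q).+1); last first.
  by apply: leq_trans (size_polyMleq _ _) _; rewrite size_polyX addn2.
rewrite big_ord_recl coefMX eqxx scale0r add0r; apply: eq_bigr => i _.
by rewrite coefMX lift0 iterSr.
Qed.

Lemma chorner_opMXC q (a : R[i]) A x :
  chorner_op (q * 'X + a%:P) A x = chorner_op q A (A x) + a *: x.
Proof. by rewrite chorner_opD chorner_opMX chorner_opC. Qed.

Lemma chorner_op0 A x : chorner_op 0 A x = 0.
Proof. by rewrite -polyC0 chorner_opC scale0r. Qed.

Lemma bounded_chorner_op q A : bounded_op A -> bounded_op (chorner_op q A).
Proof.
move=> bA; elim/poly_ind: q => [|q a IHq].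
  rewrite (_ : chorner_op 0 A = 0%:C *: idfun).
    by apply: bounded_scale; exact: bounded_id.
  by apply/funext => x; rewrite chorner_op0 scaleopE scale0r.
rewrite (_ : chorner_op _ A = (chorner_op q A \o A) + a *: idfun).
  by apply: bounded_add; [exact: bounded_comp|apply: bounded_scale; exact: bounded_id].
by apply/funext => x; rewrite chorner_opMXC.
Qed.

Lemma chorner_op_comm q A x : bounded_op A ->
  A (chorner_op q A x) = chorner_op q A (A x).
Proof.
move=> bA; elim/poly_ind: q x => [|q a IHq] x; first by rewrite !chorner_op0 op0.
by rewrite !chorner_opMXC (opD bA) (opZ bA) IHq.
Qed.

Lemma chorner_opM q r A x : bounded_op A ->
  chorner_op (q * r) A x = chorner_op q A (chorner_op r A x).
Proof.
move=> bA; elim/poly_ind: q x => [|q a IHq] x; first by rewrite mul0r !chorner_op0.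
rewrite mulrDl mulrAC chorner_opD chorner_opMX mul_polyC chorner_opZ.
by rewrite chorner_opMXC IHq chorner_op_comm.
Qed.

(** Over the complex numbers, q(A) is a product of factors A - z with z a root of
q, each of which is invertible. *)
Lemma invertible_chorner_op q A : bounded_op A -> q != 0 ->
  (forall z, spectrum A z -> q.[z] != 0) -> invertible_op (chorner_op q A).
Proof.
move=> bA q0 qA; have [r qr] := closed_field_poly_normal q.
move: q0 qA; rewrite {}qr; move: (lead_coef q) => c.
have [->|c0] := eqVneq c 0; first by rewrite scale0r eqxx.
move=> _; elim: r => [|z r IHr] qA.
  exists (c^-1 *: idfun); split; first by apply: bounded_scale; exact: bounded_id.
    apply/funext => x; rewrite big_nil -mul_polyC mulr1 /= chorner_opC scaleopE.
    by rewrite scalerA divff // scale1r.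
  apply/funext => x; rewrite big_nil -mul_polyC mulr1 /= chorner_opC scaleopE.
  by rewrite scalerA mulVf // scale1r.
rewrite big_cons (_ : chorner_op _ A =
  (A - z *: idfun) \o chorner_op (c *: \prod_(z <- r) ('X - z%:P)) A).
  apply: invertible_comp.
    apply: contrapT => Az; have := qA z Az.
    by rewrite big_cons hornerZ hornerM hornerXsubC subrr mul0r mulr0 eqxx.
  apply: IHr => w Aw; apply: contraNneq (qA w Aw).
  by rewrite big_cons !hornerZ hornerM mulrCA => ->; rewrite mulr0.
apply/funext => x; rewrite scalerAr chorner_opM //=.
rewrite -[X in chorner_op (X - _)]mul1r -polyCN chorner_opMXC.
by rewrite chorner_opC scale1r scaleNr.
Qed.

Lemma horner_opE p A : horner_op p A = chorner_op (map_poly (real_complex R) p) A.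
Proof.
apply/funext => x; rewrite /chorner_op size_map_poly; apply: eq_bigr => i _.
by rewrite coef_map.
Qed.

Lemma horner_opD p r A x : horner_op (p + r) A x = horner_op p A x + horner_op r A x.
Proof. by rewrite !horner_opE rmorphD chorner_opD. Qed.

Lemma horner_opC a A x : horner_op a%:P A x = a%:C *: x.
Proof. by rewrite !horner_opE map_polyC chorner_opC. Qed.

Lemma horner_opX A x : horner_op 'X A x = A x.
Proof.
by rewrite horner_opE map_polyX -['X]mul1r chorner_opMX chorner_opC scale1r.
Qed.

Lemma horner_opZ a p A x : horner_op (a *: p) A x = a%:C *: horner_op p A x.
Proof. by rewrite !horner_opE map_polyZ chorner_opZ. Qed.

Lemma horner_opN p A x : horner_op (- p) A x = - horner_op p A x.
Proof. by rewrite -scaleN1r horner_opZ rmorphN1 scaleN1r. Qed.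

Lemma horner_opB p r A x : horner_op (p - r) A x = horner_op p A x - horner_op r A x.
Proof. by rewrite horner_opD horner_opN. Qed.

Lemma horner_opM p r A x : bounded_op A ->
  horner_op (p * r) A x = horner_op p A (horner_op r A x).
Proof. by move=> bA; rewrite !horner_opE rmorphM chorner_opM. Qed.

Lemma bounded_horner_op p A : bounded_op A -> bounded_op (horner_op p A).
Proof. by rewrite horner_opE; exact: bounded_chorner_op. Qed.

Lemma self_adjoint_horner_op p A : self_adjoint A -> self_adjoint (horner_op p A).
Proof.
move=> sA; have bA := sA.1.
apply: self_adjointI => [|x y]; first exact: bounded_horner_op.
elim/poly_ind: p x y => [|p a IHp] x y.
  by rewrite -polyC0 !horner_opC rdotZl rdotZr mul0r.
rewrite !horner_opD !horner_opC rdotDl rdotDr rdotZl rdotZr; congr (_ + _).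
by rewrite {1}mulrC !horner_opM // !horner_opX self_adjoint_rdot // IHp.
Qed.

(** If all A - t are invertible, then [nonneg_of_resolvent] bounds A below by
every real number, which leaves room for the zero vector only. *)
Lemma spectrum0_trivial A : self_adjoint A ->
  (forall t, ~ spectrum A t%:C) -> forall x : H, x = 0.
Proof.
move=> sA A0 x; have Age l : 0 <= rdot x (A x) - l * rnorm x ^+ 2.
  have sl : self_adjoint (A - l%:C *: idfun).
    apply: self_adjoint_sub => //; apply: self_adjoint_scale; exact: self_adjoint_id.
  rewrite -rdotxx -rdotZr -rdotBr.
  apply: (nonneg_of_resolvent sl) => t _.
  rewrite -addrA -opprD -scalerDl -rmorphD; apply: contrapT; exact: A0.
apply: rnorm0_eq0; apply/eqP/negP => /negP x0.
have := Age ((rdot x (A x) + 1) / rnorm x ^+ 2).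
by rewrite divfK ?sqrf_eq0 // opprD addrA subrr sub0r oppr_ge0 ler10.
Qed.

(** For t < 0, the polynomial p - t has no root in the spectrum, so p(A) - t is
invertible. *)
Lemma horner_op_ge0 p A : self_adjoint A ->
  (forall t, spectrum A t%:C -> 0 <= p.[t]) ->
  forall x, 0 <= rdot x (horner_op p A x).
Proof.
move=> sA p0; apply: nonneg_of_resolvent; first exact: self_adjoint_horner_op.
move=> t t0; rewrite (_ : _ - _ = horner_op (p - t%:P) A); last first.
  by apply/funext => x; rewrite horner_opB horner_opC.
have pt0 s : spectrum A s%:C -> (p - t%:P).[s] != 0.
  by move=> /p0; rewrite hornerD hornerN hornerC => ps; rewrite gt_eqF //; lra.
(* p - t vanishes only if the spectrum is empty, that is, if the space is trivial *)
have [pt|pt] := eqVneq (p - t%:P) 0.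
  have H0 x y : x = y.
    have z := @spectrum0_trivial A sA _; rewrite (z _ x) ?(z _ y) // => s /pt0;
      by rewrite pt horner0 eqxx.
  by exists idfun; split; first exact: bounded_id; apply/funext => x; exact: H0.
rewrite horner_opE; apply: invertible_chorner_op; first exact: sA.1.
  by rewrite map_poly_eq0.
move=> z Az; have z0 := spectrum_real sA Az; case: z Az z0 => a b Az /= b0.
rewrite b0 in Az *; rewrite complexr0 horner_map /=.
by rewrite -(rmorph0 (real_complex R)) (inj_eq (@complexI _)) pt0.
Qed.

Lemma horner_op_norm_le p A e : self_adjoint A -> 0 <= e ->
  (forall t, spectrum A t%:C -> `|p.[t]| <= e) ->
  forall x, rnorm (horner_op p A x) <= e * rnorm x.
Proof.
move=> sA e0 pe x.
rewrite -(@ler_pXn2r _ 2) ?nnegrE ?rnorm_ge0 ?mulr_ge0 ?rnorm_ge0 //.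
have := @horner_op_ge0 ((e ^+ 2)%:P - p * p) A sA _ x.
rewrite horner_opB horner_opC rdotBr rdotZr rdotxx horner_opM; last exact: sA.1.
rewrite -self_adjoint_rdot; last exact: self_adjoint_horner_op.
rewrite rdotxx exprMn subr_ge0; apply=> t /pe pt.
rewrite hornerD hornerN hornerC hornerM -expr2 subr_ge0 -real_normK ?num_real //.
by rewrite ler_pXn2r ?nnegrE.
Qed.

End PolyCalculus.

(** * Bernstein approximation of Lipschitz functions *)

Section Bernstein.
Context {R : realType}.
Implicit Types (f : R -> R) (g h : nat -> R) (u a b c e t x y : R) (n : nat).

(** The argument is the sequence of values at the nodes, which need not come from
a function on the unit interval: this turns the binomial moments into Bernstein
sums of polynomials in k. *)
Definition bernstein n g u : R :=
  \sum_(k < n.+1) 'C(n, k)%:R * u ^+ k * (1 - u) ^+ (n - k) * g k.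

Lemma bernstein1 n u : bernstein n (fun=> 1) u = 1.
Proof.
rewrite -[RHS](expr1n _ n) -{2}(subrK u 1) exprDn; apply: eq_bigr => k _.
by rewrite mulr1 -mulrA mulr_natl mulrC.
Qed.

Lemma bernsteinD n g h u :
  bernstein n (fun k => g k + h k) u = bernstein n g u + bernstein n h u.
Proof. by rewrite -big_split; apply: eq_bigr => k _; rewrite mulrDr. Qed.

Lemma bernsteinZ n c g u : bernstein n (fun k => c * g k) u = c * bernstein n g u.
Proof. by rewrite mulr_sumr; apply: eq_bigr => k _; rewrite mulrCA. Qed.

Lemma bernstein_cst n c u : bernstein n (fun=> c) u = c.
Proof.
rewrite -[RHS]mulr1 -(bernstein1 n u) -bernsteinZ.
by apply: eq_bigr => k _; rewrite mulr1.
Qed.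

(** The identity k C(n+1,k) = (n+1) C(n,k-1), from which the moments of the
binomial distribution follow. *)
Lemma bernstein_shift n g u :
  bernstein n.+1 (fun k => k%:R * g k) u = n.+1%:R * u * bernstein n (g \o succn) u.
Proof.
rewrite /bernstein big_ord_recl mul0r mulr0 add0r mulr_sumr; apply: eq_bigr => k _.
rewrite lift0 subSS exprS /=.
have := mul_bin_diag n.+1 k; rewrite -pred_Sn => /(congr1 (fun m => m%:R : R)).
rewrite !natrM => e.
transitivity (k.+1%:R * 'C(n.+1, k.+1)%:R *
    (u * u ^+ k * (1 - u) ^+ (n - k) * g k.+1)); first by ring.
by rewrite -e; ring.
Qed.

Lemma bernstein_mean n u : bernstein n (fun k => k%:R) u = n%:R * u.
Proof.
case: n => [|n]; first by rewrite /bernstein big_ord1 mulr0 mul0r.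
rewrite (_ : (fun k => k%:R) = (fun k : nat => k%:R * 1)); last first.
  by apply/funext => k; rewrite mulr1.
by rewrite bernstein_shift bernstein1 mulr1.
Qed.

Lemma bernstein_variance n u :
  bernstein n.+1 (fun k => (k%:R / n.+1%:R - u) ^+ 2) u = u * (1 - u) / n.+1%:R.
Proof.
have n0 : n.+1%:R != 0 :> R by rewrite pnatr_eq0.
set N := n.+1%:R in n0 *.
rewrite (_ : (fun k : nat => _) = (fun k : nat => N ^- 2 * (k%:R * k%:R) +
   ((- (2 * u / N)) * k%:R + u ^+ 2 * 1))); last first.
  by apply/funext => k; field.
rewrite !(bernsteinD, bernsteinZ) bernstein_mean bernstein1 bernstein_shift.
rewrite (_ : _ \o _ = (fun k : nat => k%:R + 1)); last first.
  by apply/funext => k /=; rewrite -natr1.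
rewrite bernsteinD bernstein_mean bernstein1 -/N.
have -> : n%:R = N - 1 by rewrite /N -natr1 addrK.
by field.
Qed.

Lemma bernstein_le n g h u : 0 <= u <= 1 ->
  (forall k, (k <= n)%N -> g k <= h k) -> bernstein n g u <= bernstein n h u.
Proof.
move=> /andP[u0 u1] gh; apply: ler_sum => k _; apply: ler_wpM2l.
  by rewrite !mulr_ge0 ?exprn_ge0 // subr_ge0.
by apply: gh; rewrite -ltnS.
Qed.

Definition lipschitz_itv a b f := exists L, forall x y,
  a <= x <= b -> a <= y <= b -> `|f x - f y| <= L * `|x - y|.

(** The error at t is a Bernstein average of the differences between f at the
nodes and f t.  With K a Lipschitz constant after rescaling to the unit interval,
each is at most K |w| <= K (d + w^2 / d), where w is the distance in that scale,
and the average of w^2 is at most 1 / n. *)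
Lemma lipschitz_poly_approx f a b : a < b -> lipschitz_itv a b f ->
  forall e, 0 < e -> exists p : {poly R}, forall t, a <= t <= b -> `|p.[t] - f t| <= e.
Proof.
move=> ab [L fL] e e0; have ab0 : 0 < b - a by rewrite subr_gt0.
pose K := `|L| * (b - a) + 1.
have K0 : 0 < K by rewrite ltr_wpDl // mulr_ge0 // ltW.
pose d := e / (2 * K); have d0 : 0 < d by rewrite divr_gt0 // mulr_gt0.
(* 1 / (n d) <= d balances the two terms of the error *)
pose n := Num.truncn (d ^- 2); pose N : R := n.+1%:R.
have N0 : 0 < N by rewrite ltr0n.
have Nd : (N * d)^-1 <= d.
  have : d ^- 2 <= N by rewrite ltW // /N truncnS_gt.
  rewrite -[d ^- 2]mul1r ler_pdivrMr ?exprn_gt0 // => dN.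
  have Nd0 : 0 < N * d by rewrite mulr_gt0.
  by rewrite -(ler_pM2r Nd0) mulVf ?gt_eqF // mulrCA -expr2.
pose node k := a + (b - a) * (k%:R / N).
pose U : {poly R} := (b - a)^-1 *: ('X - a%:P).
exists (\sum_(k < n.+2)
  ('C(n.+1, k)%:R * f (node k)) *: (U ^+ k * (1 - U) ^+ (n.+1 - k))).
move=> t tab; pose u := (t - a) / (b - a).
have tu : t = a + (b - a) * u by rewrite /u; field; rewrite gt_eqF.
have u01 : 0 <= u <= 1.
  have /andP[h1 h2] := tab.
  by rewrite divr_ge0 ?subr_ge0 ?(ltW ab) //= ler_pdivrMr // mul1r lerB.
rewrite (_ : _.[t] = bernstein n.+1 (fun k => f (node k)) u); last first.
  rewrite horner_sum; apply: eq_bigr => k _.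
  rewrite hornerZ hornerM !horner_exp hornerD hornerN hornerC hornerZ hornerXsubC.
  by rewrite -/u [_ * (t - a)]mulrC -/u; ring.
rewrite -(bernstein_cst n.+1 (f t) u) -mulN1r -bernsteinZ -bernsteinD.
set G := fun k : nat => _.
have GK k : (k <= n.+1)%N -> `|G k| <= K * (d + d^-1 * (k%:R / N - u) ^+ 2).
  move=> kn.
  have Gk : `|G k| <= (K - 1) * `|k%:R / N - u|.
    rewrite /G mulN1r.
    have nodeab : a <= node k <= b.
      have k0 : 0 <= k%:R / N :> R by rewrite divr_ge0 // ltW.
      have k1 : k%:R / N <= 1 :> R by rewrite ler_pdivrMr // mul1r ler_nat.
      rewrite /node lerDl mulr_ge0 ?(ltW ab0) //=.
      by rewrite -lerBrDl ler_piMr // ltW.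
    apply: le_trans (fL _ _ nodeab tab) _; rewrite [in leLHS]tu /node.
    rewrite (_ : a + _ - _ = (b - a) * (k%:R / N - u)); last by ring.
    rewrite normrM (gtr0_norm ab0) mulrA addrK ler_wpM2r // ler_wpM2r ?(ltW ab0) //.
    exact: ler_norm.
  apply: le_trans Gk _; set w := k%:R / N - u.
  have h : `|w| <= d + d^-1 * w ^+ 2.
    have := sqr_ge0 (d - `|w|); rewrite -[w ^+ 2]real_normK ?num_real // => hw.
    rewrite -(ler_pM2l d0) mulrDr mulVKf ?gt_eqF // -expr2.
    have : 0 <= d * `|w| by rewrite mulr_ge0 // ltW.
    by move: hw; rewrite sqrrB; lra.
  apply: le_trans (_ : K * `|w| <= _); first by rewrite ler_wpM2r // gerBl.
  by rewrite ler_wpM2l // ltW.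
have total : K * (d + d^-1 * (u * (1 - u) / N)) <= e.
  have Kd : K * (d * 2) = e by rewrite /d; field; rewrite gt_eqF.
  rewrite -Kd ler_wpM2l ?(ltW K0) // mulr_natr mulr2n lerD2l.
  have /andP[h1 h2] := u01.
  have fE (x y z : R) : y^-1 * (x / z) = x * (z * y)^-1.
    by rewrite invfM mulrCA [y^-1 * _]mulrC.
  rewrite fE.
  apply: le_trans Nd; apply: ler_piMl.
    by rewrite invr_ge0 mulr_ge0 // ltW.
  by apply: mulr_ile1; rewrite ?subr_ge0 // gerBl.
have bK : bernstein n.+1 (fun k => K * (d + d^-1 * (k%:R / N - u) ^+ 2)) u
    = K * (d + d^-1 * (u * (1 - u) / N)).
  by rewrite bernsteinZ bernsteinD bernstein_cst bernsteinZ bernstein_variance.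
apply: le_trans total; rewrite -bK ler_norml; apply/andP; split.
  rewrite -[- bernstein _ _ _]mulN1r -bernsteinZ; apply: bernstein_le => // k kn.
  by rewrite mulN1r; have := GK k kn; rewrite ler_norml => /andP[].
apply: bernstein_le => // k kn.
by have := GK k kn; rewrite ler_norml => /andP[].
Qed.

(** A power is monotone, in one direction or the other according to the sign of
its exponent, so one of the two end values is a bound; their sum avoids the
distinction. *)
Lemma powR_le_ends a b c r : 0 < a -> a <= c <= b -> c `^ r <= a `^ r + b `^ r.
Proof.
move=> a0 /andP[ac cb]; have c0 := lt_le_trans a0 ac; have b0 := lt_le_trans c0 cb.
have [r0|r0] := leP 0 r.
  apply: le_trans (_ : b `^ r <= _); last by rewrite lerDr powR_ge0.
  by rewrite ge0_ler_powR ?nnegrE // ltW.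
apply: le_trans (_ : a `^ r <= _); last by rewrite lerDl powR_ge0.
rewrite -[r]opprK !(powRN _ (- r)) lef_pV2 ?posrE ?powR_gt0 //.
by rewrite ge0_ler_powR ?nnegrE ?oppr_ge0 // ltW.
Qed.

Lemma lipschitz_powR a b r : 0 < a -> lipschitz_itv a b (fun t => t `^ r).
Proof.
move=> a0; pose L := `|r| * (a `^ (r - 1) + b `^ (r - 1)); exists L.
have L0 : 0 <= L by rewrite mulr_ge0 // addr_ge0 // powR_ge0.
suff lt_case x y : a <= x <= b -> a <= y <= b -> x < y ->
    `|x `^ r - y `^ r| <= L * `|x - y|.
  move=> x y xab yab; have [xy|yx|->] := ltgtP x y; first exact: lt_case.
    by rewrite distrC (distrC x); exact: lt_case.
  by rewrite !subrr normr0 mulr0.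
move=> /andP[ax xb] /andP[ay yb] xy; have x0 := lt_le_trans a0 ax.
have dr t : x <= t -> is_derive t (1 : R) (fun t => t `^ r) (r * t `^ (r - 1)).
  by move=> xt; apply: is_derive1_powR; exact: lt_le_trans x0 xt.
have [||c] := MVT (f := fun t => t `^ r) (df := fun t => r * t `^ (r - 1)) xy.
- by move=> t; rewrite in_itv /= => /andP[xt _]; apply: dr; exact: ltW.
- apply: derivable_within_continuous => t; rewrite in_itv /= => /andP[xt _].
  by have [] := dr t xt.
rewrite in_itv /= => /andP[xc cy] e.
rewrite distrC e normrM (distrC x) ler_wpM2r // normrM ler_wpM2l //.
rewrite ger0_norm ?powR_ge0 //; apply: powR_le_ends => //.
by rewrite (le_trans ax (ltW xc)) (le_trans (ltW cy) yb).
Qed.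

Lemma lipschitz_affine a b f c d : lipschitz_itv a b f ->
  lipschitz_itv a b (fun t => c + d * f t).
Proof.
move=> [L fL]; exists (`|d| * L) => x y xab yab.
rewrite opprD addrACA subrr add0r -mulrBr normrM -mulrA ler_wpM2l //.
exact: fL.
Qed.

Lemma lipschitz_inv a b f c : 0 < c -> (forall t, a <= t <= b -> c <= f t) ->
  lipschitz_itv a b f -> lipschitz_itv a b (fun t => (f t)^-1).
Proof.
move=> c0 cf [L fL]; exists (c^-1 * c^-1 * L) => x y xab yab.
have fx := lt_le_trans c0 (cf x xab); have fy := lt_le_trans c0 (cf y yab).
have -> : (f x)^-1 - (f y)^-1 = (f x)^-1 * (f y)^-1 * (f y - f x).
  by field; rewrite !gt_eqF.
rewrite normrM -[leRHS]mulrA ger0_norm; last by rewrite mulr_ge0 // invr_ge0 ltW.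
apply: ler_pM => //; first by rewrite mulr_ge0 // invr_ge0 ltW.
  have inv_le z : a <= z <= b -> 0 < f z -> (f z)^-1 <= c^-1.
    by move=> zab fz; rewrite lef_pV2 ?posrE // cf.
  by apply: ler_pM; rewrite ?inv_le ?invr_ge0 ?(ltW fx) ?(ltW fy).
by rewrite distrC; exact: fL.
Qed.

End Bernstein.

(** * Continuous functional calculus *)

Section Calculus.
Context {R : realType} {H : hilbertType R}.
Implicit Types (A B S T : H -> H) (x y : H) (a b c M t e : R).
Implicit Types (p q : {poly R}) (f g : R -> R).

(** The operator norm is a supremum over the unit ball; scaling gives the bound
for all vectors. *)
Lemma op_normP A x : bounded_op A -> rnorm (A x) <= op_norm A * rnorm x.
Proof.
move=> bA; have [M M0 AM] := bounded_opP bA.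
have ub y : `|y| <= 1 -> rnorm (A y) <= op_norm A.
  move=> y1; apply: ub_le_sup; last by exists y.
  exists M => _ [z /= z1 <-]; apply: le_trans (AM z) _.
  by rewrite -[leRHS]mulr1 ler_wpM2l ?(ltW M0) // -lecR -normE.
have [x0|x0] := eqVneq (rnorm x) 0.
  by rewrite (rnorm0_eq0 x0) (op0 bA) rnorm0 mulr0.
have xp : 0 < rnorm x by rewrite lt_neqAle eq_sym x0 rnorm_ge0.
rewrite -ler_pdivrMr // mulrC -[(rnorm x)^-1]ger0_norm ?invr_ge0 ?rnorm_ge0 //.
rewrite -rnormZ -(opZ bA); apply: ub.
by rewrite normE rnormZ ger0_norm ?invr_ge0 ?rnorm_ge0 // mulVf.
Qed.

Lemma op_norm_le A e : linear A -> 0 <= e ->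
  (forall x, rnorm (A x) <= e * rnorm x) -> 0 <= op_norm A <= e.
Proof.
move=> lA e0 Ae; have bA := bounded_opI lA Ae.
have ub : ubound [set complex.Re `|A x| | x in [set x : H | `|x| <= 1]]%classic e.
  move=> _ [z /= z1 <-]; apply: le_trans (Ae z) _.
  by rewrite -[leRHS]mulr1 ler_wpM2l // -lecR -normE.
have A0 : [set complex.Re `|A x| | x in [set x : H | `|x| <= 1]]%classic 0.
  by exists 0; rewrite ?(op0 bA) /= ?normr0 ?ler01.
apply/andP; split; first by apply: ub_le_sup => //; exists e.
by apply: ge_sup => //; exists 0.
Qed.

Lemma spectrum_ge A a t : self_adjoint A ->
  (forall x, a * rnorm x ^+ 2 <= rdot x (A x)) -> spectrum A t%:C -> a <= t.
Proof.
move=> sA aA At; rewrite leNgt; apply/negP => ta; apply: At.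
have bI : bounded_op (t%:C *: (idfun : H -> H)).
  by apply: bounded_scale; exact: bounded_id.
apply: (@lax_milgram _ _ _ (a - t)); first exact: bounded_sub sA.1 bI.
  by rewrite subr_gt0.
by move=> x; rewrite rdotBr rdotZr rdotxx mulrBl lerB.
Qed.

Lemma spectrum_le A b t : self_adjoint A ->
  (forall x, rdot x (A x) <= b * rnorm x ^+ 2) -> spectrum A t%:C -> t <= b.
Proof.
move=> sA Ab At; rewrite leNgt; apply/negP => bt; apply: At.
set T := A - _.
have bT : bounded_op T.
  by apply: bounded_sub sA.1 _; apply: bounded_scale; exact: bounded_id.
have [||x|B [bB TB BT]] := @lax_milgram _ _ (- T) (t - b).
- exact: bounded_opp.
- by rewrite subr_gt0.
- rewrite -[X in rdot x X]/(- (A x - t%:C *: x)) rdotNr rdotBr rdotZr rdotxx.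
  by rewrite opprB mulrBl lerB.
exists (- B); split; first exact: bounded_opp.
  apply/funext => x; rewrite -[LHS]/(T (- B x)) (opN bT).
  exact: (congr1 (@^~ x) TB).
apply/funext => x; rewrite -[LHS]/(- B (T x)) -(opN bB).
exact: (congr1 (@^~ x) BT).
Qed.

Lemma spectrum_bounded A : self_adjoint A ->
  exists M, forall t, spectrum A t%:C -> `|t| <= M.
Proof.
move=> sA; have [M M0 AM] := bounded_opP sA.1; exists M => t At.
have Mx x : rnorm x * rnorm (A x) <= M * rnorm x ^+ 2.
  by rewrite expr2 mulrCA ler_wpM2l ?rnorm_ge0.
rewrite ler_norml; apply/andP; split.
  apply: spectrum_ge At => // x; apply: le_trans (rdot_ge _ _).
  by rewrite mulNr lerN2.
by apply: spectrum_le At => // x; apply: le_trans (rdot_le _ _) _.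
Qed.

(** One polynomial for each precision replaces the two limits in [is_cfc]; this is
the form in which the calculus is computed. *)
Definition calc f A S := bounded_op S /\ forall e, 0 < e -> exists p,
  (forall t, spectrum A t%:C -> `|p.[t] - f t| <= e) /\
  forall x, rnorm (horner_op p A x - S x) <= e * rnorm x.

Lemma calc_of_cfc f A S : bounded_op A -> is_cfc f A S -> calc f A S.
Proof.
move=> bA [bS [p [pf pS]]]; split=> // e e0.
have /cvgrPdist_le /(_ e e0) [n _ pSn] := pS.
have [m _ pfm] : (\forall n \near \oo,
    forall t, spectrum A t%:C -> `|(p n).[t] - f t| < e)%classic.
  have := pf [set h | forall t, spectrum A t%:C -> `|h t - f t| < e]%classic.
  apply; apply/uniform_nbhs; exists [set xy | `|xy.2 - xy.1| < e]%classic; split.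
    rewrite -entourage_ballE; exists e => // -[u v] /=.
    by rewrite -ball_normE /= distrC.
  by move=> h hf t At; apply: hf.
exists (p (maxn n m)); split.
  by move=> t At; apply/ltW/(pfm _ (leq_maxr _ _)).
move=> x; have bD : bounded_op (horner_op (p (maxn n m)) A - S).
  by apply: bounded_sub => //; exact: bounded_horner_op.
apply: le_trans (op_normP x bD) _; rewrite ler_wpM2r ?rnorm_ge0 //.
have := pSn _ (leq_maxl n m); rewrite /= sub0r normrN; apply: le_trans.
exact: ler_norm.
Qed.

Lemma calc_horner p A : bounded_op A -> calc (horner p) A (horner_op p A).
Proof.
move=> bA; split; first exact: bounded_horner_op.
move=> e e0; exists p; split=> [t _|x]; first by rewrite subrr normr0 ltW.
by rewrite subrr rnorm0 mulr_ge0 ?rnorm_ge0 // ltW.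
Qed.

Lemma calc_ext f g A S : (forall t, spectrum A t%:C -> f t = g t) ->
  calc f A S -> calc g A S.
Proof.
move=> fg [bS fS]; split=> // e /fS[p [pf pS]]; exists p; split=> // t At.
by rewrite -fg //; exact: pf.
Qed.

Lemma calcD f g A S T : calc f A S -> calc g A T ->
  calc (fun t => f t + g t) A (S + T).
Proof.
move=> [bS fS] [bT gT]; split; first exact: bounded_add.
move=> e e0; have e20 : 0 < e / 2 by rewrite divr_gt0.
have [p [pf pS]] := fS _ e20; have [q [qg qT]] := gT _ e20.
exists (p + q); split=> [t At|x].
  rewrite hornerD opprD addrACA; apply: le_trans (ler_normD _ _) _.
  by have := pf t At; have := qg t At; lra.
rewrite horner_opD opprD addrACA; apply: le_trans (rnormD _ _) _.
by have := pS x; have := qT x; lra.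
Qed.

Lemma calcZ a f A S : calc f A S -> calc (fun t => a * f t) A (a%:C *: S).
Proof.
move=> [bS fS]; split; first exact: bounded_scale.
move=> e e0; have a1 : 0 < `|a| + 1 by rewrite ltr_wpDl.
have ea : `|a| * (e / (`|a| + 1)) <= e.
  by rewrite mulrCA ler_piMr ?(ltW e0) // ler_pdivrMr // mul1r lerDl.
have [p [pf pS]] := fS _ (divr_gt0 e0 a1).
exists (a *: p); split=> [t At|x].
  by rewrite hornerZ -mulrBr normrM; apply: le_trans ea; rewrite ler_wpM2l // pf.
rewrite horner_opZ scaleopE -scalerBr rnormZ.
apply: le_trans (ler_wpM2l (normr_ge0 a) (pS x)) _.
by rewrite mulrA ler_wpM2r ?rnorm_ge0.
Qed.

(** f is uniformly close to a polynomial, and the spectrum is bounded. *)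
Lemma calc_bounded f A S : self_adjoint A -> calc f A S ->
  exists2 K, 0 < K & forall t, spectrum A t%:C -> `|f t| <= K.
Proof.
move=> sA [_ /(_ 1 ltr01)[p [pf _]]]; have [M AM] := spectrum_bounded sA.
have [K K0 pK] : exists2 K, 0 <= K & forall t, `|t| <= M -> `|p.[t]| <= K.
  elim/poly_ind: p {pf} => [|p a [K K0 IHp]].
    by exists 0 => // t _; rewrite horner0 normr0.
  exists (K * `|M| + `|a|) => [|t tM]; first by rewrite addr_ge0 // mulr_ge0.
  rewrite hornerMXaddC; apply: le_trans (ler_normD _ _) _; rewrite lerD2r normrM.
  by rewrite ler_pM // ?IHp // (le_trans tM) // ler_norm.
exists (K + 1) => [|t At]; first by rewrite ltr_wpDl.
have := pf t At; have := pK t (AM t At); have := ler_distD 0 (f t) p.[t].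
have := ler_normB p.[t] (p.[t] - f t); rewrite opprB addrC subrK; lra.
Qed.

(** From p q - f g = p (q - g) + (p - f) g, for numbers and for operators; the
factors are bounded, f and g on the spectrum by [calc_bounded]. *)
Lemma calcM f g A S T : self_adjoint A -> calc f A S -> calc g A T ->
  calc (fun t => f t * g t) A (S \o T).
Proof.
move=> sA cf cg; have [F F0 fF] := calc_bounded sA cf.
have [G G0 gG] := calc_bounded sA cg.
have [bS fS] := cf; have [bT gT] := cg; have bA := sA.1.
have [K K0 SK] := bounded_opP bS; have [L L0 TL] := bounded_opP bT.
split; first exact: bounded_comp.
(* D collects the coefficients of d in both errors, d <= 1 absorbing d^2 into d *)
move=> e e0; pose D := F + G + K + L + 1.
have D0 : 0 < D by rewrite /D; lra.
pose d := Num.min 1 (e / D).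
have d0 : 0 < d by rewrite lt_min ltr01 divr_gt0.
have d1 : d <= 1 by rewrite ge_min lexx.
have dD : d * D <= e by rewrite -ler_pdivlMr // ge_min lexx orbT.
have dd : d * d <= d by rewrite ler_piMl // ltW.
have [p [pf pS]] := fS _ d0; have [q [qg qT]] := gT _ d0.
exists (p * q); split=> [t At|x].
  rewrite hornerM (_ : _ - _ = p.[t] * (q.[t] - g t) + (p.[t] - f t) * g t);
    last by ring.
  apply: le_trans (ler_normD _ _) _; rewrite !normrM.
  have pF : `|p.[t]| <= F + d.
    have := pf t At; have := fF t At.
    by have := ler_normD (p.[t] - f t) (f t); rewrite subrK; lra.
  have h1 : `|p.[t]| * `|q.[t] - g t| <= (F + d) * d by rewrite ler_pM // qg.
  have h2 : `|p.[t] - f t| * `|g t| <= d * G by rewrite ler_pM // ?pf ?gG.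
  have : 0 <= d * K by rewrite mulr_ge0 // ltW.
  have : 0 <= d * L by rewrite mulr_ge0 // ltW.
  by move: dD; rewrite /D; lra.
rewrite horner_opM // -[(S \o T) x]/(S (T x)).
set y := horner_op q A x.
have bp := bounded_horner_op p bA.
apply: le_trans (rnorm_triangle _ (horner_op p A (T x)) _) _.
rewrite -(opB bp).
have pK z : rnorm (horner_op p A z) <= (K + d) * rnorm z.
  have := pS z; have := SK z; have := rnormD (horner_op p A z - S z) (S z).
  by rewrite subrK; lra.
have h1 : rnorm (horner_op p A (y - T x)) <= (K + d) * (d * rnorm x).
  by apply: le_trans (pK _) _; rewrite ler_wpM2l ?qT //; lra.
have h2 : rnorm (horner_op p A (T x) - S (T x)) <= d * (L * rnorm x).
  by apply: le_trans (pS _) _; rewrite ler_wpM2l // ltW.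
have x0 := rnorm_ge0 x.
have := ler_wpM2r x0 dD; have := ler_wpM2r x0 dd.
have : 0 <= d * (F * rnorm x) by rewrite !mulr_ge0 // ltW.
have : 0 <= d * (G * rnorm x) by rewrite !mulr_ge0 // ltW.
by rewrite /D; lra.
Qed.

(** If p is within d of f, then p + d >= 0 on the spectrum, so p(A) + d is
positive. *)
Lemma calc_ge0 f A S : self_adjoint A -> calc f A S ->
  (forall t, spectrum A t%:C -> 0 <= f t) -> forall x, 0 <= rdot x (S x).
Proof.
move=> sA [bS fS] f0 x; apply/ler_addgt0Pr => e e0.
have K0 : 0 < rnorm x ^+ 2 * 2 + 1 by rewrite ltr_wpDl ?mulr_ge0 ?exprn_ge0 ?rnorm_ge0.
have [p [pf pS]] := fS _ (divr_gt0 e0 K0); set d := e / _ in pf pS.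
have d0 : 0 < d by rewrite divr_gt0.
have := @horner_op_ge0 R H (p + d%:P) A sA _ x.
rewrite horner_opD horner_opC rdotDr rdotZr rdotxx => /(_ _)/wrap[t At|h].
  rewrite hornerD hornerC; have := pf t At; rewrite ler_norml => /andP[+ _].
  by have := f0 t At; lra.
have := rdot_le x (horner_op p A x - S x); rewrite rdotBr.
have := ler_wpM2l (rnorm_ge0 x) (pS x); rewrite mulrCA -expr2.
have : d * (rnorm x ^+ 2 * 2 + 1) = e by rewrite divfK // gt_eqF.
lra.
Qed.

Lemma calc_self_adjoint f A S : self_adjoint A -> calc f A S -> self_adjoint S.
Proof.
move=> sA [bS fS]; apply: self_adjointI => // x y.
apply/eqP; rewrite -subr_eq0 -normr_le0; apply/ler_addgt0Pr => e e0; rewrite add0r.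
pose K := rnorm x * rnorm y; have K0 : 0 <= K by rewrite mulr_ge0 ?rnorm_ge0.
have K1 : 0 < K * 2 + 1 by lra.
have [p [_ pS]] := fS _ (divr_gt0 e0 K1); set d := e / _ in pS.
have := self_adjoint_rdot x y (self_adjoint_horner_op p sA).
have := rdot_le (horner_op p A x - S x) y; have := rdot_ge (horner_op p A x - S x) y.
have := rdot_le x (horner_op p A y - S y); have := rdot_ge x (horner_op p A y - S y).
have := ler_wpM2l (rnorm_ge0 x) (pS y); have := ler_wpM2r (rnorm_ge0 y) (pS x).
rewrite mulrCA -mulrA -/K !rdotBr !rdotBl.
have : d * (K * 2 + 1) = e by rewrite divfK // gt_eqF.
have : 0 < d by rewrite divr_gt0.
by rewrite ler_norml => *; apply/andP; split; lra.
Qed.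

(** Two polynomials close to f on the spectrum are close to each other, and so are
their values at A by [horner_op_norm_le]. *)
Lemma calc_unique f A S T : self_adjoint A -> calc f A S -> calc f A T -> S = T.
Proof.
move=> sA [bS fS] [bT fT]; apply/funext => x; apply/eqP; rewrite -subr_eq0.
apply/eqP/rnorm_small => e e0.
have K0 : 0 < rnorm x * 4 + 1 by rewrite ltr_wpDl ?mulr_ge0 ?rnorm_ge0.
have [p [pf pS]] := fS _ (divr_gt0 e0 K0).
have [q [qf qT]] := fT _ (divr_gt0 e0 K0); set d := e / _ in pf pS qf qT.
have d0 : 0 < d by rewrite divr_gt0.
have : rnorm (horner_op (p - q) A x) <= d * 2 * rnorm x.
  apply: horner_op_norm_le => // [|t At]; first by rewrite mulr_ge0 // ltW.
  rewrite hornerD hornerN; have := pf t At; have := qf t At.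
  by rewrite (distrC q.[t]); have := ler_distD (f t) p.[t] q.[t]; lra.
rewrite horner_opB.
have := rnorm_triangle (horner_op p A x) (horner_op q A x) (T x).
have := rnorm_triangle (S x) (horner_op p A x) (T x).
rewrite (rnormB (S x) (horner_op p A x)); have := pS x; have := qT x.
have : d * (rnorm x * 4 + 1) = e by rewrite divfK // gt_eqF.
lra.
Qed.

Lemma calc_le f g A S T : self_adjoint A -> calc f A S -> calc g A T ->
  (forall t, spectrum A t%:C -> f t <= g t) ->
  forall x, rdot x (S x) <= rdot x (T x).
Proof.
move=> sA cf cg fg x; rewrite -subr_ge0 -rdotBr.
have := calc_ge0 sA (calcD cg (calcZ (-1) cf)) _ x.
rewrite -[(T + _) x]/(T x + (-1)%:C *: S x) rmorphN1 scaleN1r; apply=> t /fg.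
by rewrite mulN1r subr_ge0.
Qed.

(** The values at A of the approximating polynomials form a Cauchy sequence by
[horner_op_norm_le]; S is their pointwise limit, with an error uniform over the
unit ball. *)
Lemma cfc_exists f A : self_adjoint A ->
  (forall e, 0 < e -> exists p, forall t, spectrum A t%:C -> `|p.[t] - f t| <= e) ->
  exists S, is_cfc f A S.
Proof.
move=> sA fp; have bA := sA.1.
have [h [h0 hle hN]] : exists h : nat -> R, [/\ forall n, 0 < h n,
    forall m n, (m <= n)%N -> h n <= h m &
    forall e, 0 < e -> exists n, forall k, (n <= k)%N -> h k <= e].
  exists (fun n => n.+1%:R^-1); split=> [n|m n mn|e e0]; first by rewrite invr_gt0.
    by rewrite lef_pV2 ?posrE // ler_nat ltnS.
  exists (Num.truncn e^-1) => k nk.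
  rewrite invf_ple ?posrE //; apply: ltW; apply: lt_le_trans (truncnS_gt _) _.
  by rewrite ler_nat ltnS.
have [p pP] := choice (fun n => fp _ (h0 n)).
have pmn m n x : rnorm (horner_op (p m) A x - horner_op (p n) A x)
    <= (h m + h n) * rnorm x.
  rewrite -horner_opB; apply: horner_op_norm_le => //.
    by rewrite addr_ge0 // ltW.
  move=> t At; rewrite hornerD hornerN.
  have := pP m t At; have := pP n t At; rewrite (distrC (p n).[t]).
  have := ler_distD (f t) (p m).[t] (p n).[t]; lra.
have lim x : exists l, forall e : R, 0 < e ->
    exists n, forall k, (n <= k)%N -> rnorm (horner_op (p k) A x - l) <= e.
  apply: rnorm_complete => e e0.
  have x1 : 0 < rnorm x + 1 by rewrite ltr_wpDl ?rnorm_ge0.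
  have /hN[n nP] : 0 < e / (rnorm x + 1) / 2 by rewrite !divr_gt0.
  exists n => k; apply: le_trans (pmn _ _ _) _.
  have k1 := nP _ (leq_addr k n); have k2 := nP n (leqnn n).
  apply: (@le_trans _ _ (e / (rnorm x + 1) * rnorm x)).
    by rewrite ler_wpM2r ?rnorm_ge0 //; lra.
  by rewrite mulrAC ler_pdivrMr // ler_wpM2l ?(ltW e0) // lerDl.
have [S SP] := choice lim.
have pS n x : rnorm (horner_op (p n) A x - S x) <= (2 * h n) * rnorm x.
  apply/ler_addgt0Pr => e e0; have [m mP] := SP x e e0.
  have := mP (maxn n m) (leq_maxr _ _); have := pmn n (maxn n m) x.
  have := rnorm_triangle (horner_op (p n) A x) (horner_op (p (maxn n m)) A x) (S x).
  have : (h n + h (maxn n m)) * rnorm x <= 2 * h n * rnorm x.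
    by rewrite ler_wpM2r ?rnorm_ge0 // mulr_natl mulr2n lerD2l hle // leq_maxl.
  lra.
have lS : linear S.
  move=> a x y; apply/eqP; rewrite -subr_eq0; apply/eqP/rnorm_small => e e0.
  pose K := rnorm (a *: x + y) + (complex.Re `|a| * rnorm x + rnorm y).
  have a0 : 0 <= complex.Re `|a| by have := normr_ge0 a; rewrite lecE => /andP[].
  have K0 : 0 <= K by rewrite !addr_ge0 ?mulr_ge0 ?rnorm_ge0.
  have K1 : 0 < 2 * (K + 1) by rewrite mulr_gt0 // ltr_wpDl.
  have /hN[n /(_ n (leqnn n)) nP] : 0 < e / (2 * (K + 1)) by rewrite divr_gt0.
  have ne : 2 * h n * K <= e.
    have : h n * (2 * K) <= h n * (2 * (K + 1)).
      by rewrite ler_wpM2l ?(ltW (h0 n)) //; lra.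
    by move: nP; rewrite ler_pdivlMr //; lra.
  apply: le_trans ne.
  have bP := bounded_horner_op (p n) bA.
  rewrite (_ : _ - _ = (S (a *: x + y) - horner_op (p n) A (a *: x + y)) +
    (a *: (horner_op (p n) A x - S x) + (horner_op (p n) A y - S y))); last first.
    rewrite (opD bP) (opZ bP) scalerBr [X in _ = _ + X]addrACA -opprD.
    by rewrite [RHS]addrA subrK.
  apply: le_trans (rnormD _ _) _; rewrite /K mulrDr lerD //.
    by rewrite rnormB.
  apply: le_trans (rnormD _ _) _; rewrite mulrDr lerD //.
  by rewrite rnormZC mulrCA ler_wpM2l ?Re_norm_ge0.
have bS : bounded_op S.
  have [M M0 PM] := bounded_opP (bounded_horner_op (p 0%N) bA).
  apply: (@bounded_opI _ _ _ (M + 2 * h 0%N)) => // x.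
  have := pS 0%N x; have := PM x; rewrite rnormB mulrDl.
  have := rnormD (S x - horner_op (p 0%N) A x) (horner_op (p 0%N) A x).
  by rewrite subrK; lra.
exists S; split=> //; exists p; split.
  move=> U /uniform_nbhs[E [entE EU]].
  move: entE; rewrite -entourage_ballE => -[e /= e0 eE].
  have /hN[n nP] : 0 < e / 2 by rewrite divr_gt0.
  exists n => // k /= nk; apply: EU => t At; apply: eE => /=.
  rewrite -ball_normE /= distrC; apply: le_lt_trans (pP k t At) _.
  by apply: le_lt_trans (nP k nk) _; lra.
apply/cvgrPdist_le => e e0; have /hN[n nP] : 0 < e / 2 by rewrite divr_gt0.
exists n => // k nk /=; rewrite sub0r normrN.
have /andP[h1 h2] : 0 <= op_norm (horner_op (p k) A - S) <= 2 * h k.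
  apply: op_norm_le; last exact: pS.
    by apply: (bounded_sub (bounded_horner_op (p k) bA) bS).1.
  by rewrite mulr_ge0 // ltW.
by rewrite ger0_norm //; have := nP k nk; lra.
Qed.

End Calculus.

(** * The inequalities between real numbers *)

Section Scalar.
Context {R : realType}.
Implicit Types (s t nu : R).

Lemma ge0_of_derive_ge0 (F dF : R -> R) : F 0 = 0 ->
  (forall s : R, is_derive s (1 : R) F (dF s)) ->
  (forall s, 0 <= s -> 0 <= dF s) ->
  forall s, 0 <= s -> 0 <= F s.
Proof.
move=> F0 dFF dF0 s; rewrite le_eqVlt => /predU1P[<-|s0]; first by rewrite F0.
have [|c] := MVT (f := F) (df := dF) s0 (fun x _ => dFF x).
  by apply: derivable_within_continuous => t _; have [] := dFF t.
rewrite in_itv /= F0 !subr0 => /andP[c0 _] ->.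
by rewrite mulr_ge0 ?(ltW s0) // dF0 // ltW.
Qed.

Lemma expR_sum_ge2 s : 2 <= expR s + expR (- s).
Proof.
have e0 : 0 < expR s by exact: expR_gt0.
rewrite expRN -(ler_pM2r e0) [leRHS]mulrDl mulVf ?gt_eqF //.
by have := sqr_ge0 (expR s - 1); rewrite expr2; lra.
Qed.

Lemma sinh_ge s : 0 <= s -> 2 * s <= expR s - expR (- s).
Proof.
move=> s0; rewrite -subr_ge0.
apply: (@ge0_of_derive_ge0 (fun s => expR s - expR (- s) - 2 * s)
  (fun s => expR s + expR (- s) - 2)) s0 => [|x|x _].
- by rewrite oppr0 subrr mulr0 subrr.
- apply: is_derive_eq; rewrite /GRing.scale /=. ring.
- by rewrite subr_ge0 expR_sum_ge2.
Qed.


(** This is the upper inequality at t = exp s, multiplied by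
2 ((1-nu) + nu / t) and expanded.  The difference F of the sides vanishes at 0,
and its derivative is 4 nu (1-nu) sinh (s/2) (cosh (s/2) - exp ((nu - 1/2) s)),
where the last exponential is at most 1 for s >= 0 and nu <= 1/2. *)
Lemma exp_mean_ineq s nu : 0 <= s -> 0 <= nu <= 2^-1 ->
  2 * (1 - nu) * expR (nu * s) + 2 * nu * expR (- ((1 - nu) * s)) <=
  (1 - nu) ^+ 2 + nu ^+ 2 + 1 + nu * (1 - nu) * (expR s + expR (- s)).
Proof.
move=> s0 /andP[nu0 nu1].
pose F (s : R) := (1 - nu) ^+ 2 + nu ^+ 2 + 1 + nu * (1 - nu) * (expR s + expR (- s))
  - 2 * (1 - nu) * expR (nu * s) - 2 * nu * expR (- ((1 - nu) * s)).
pose dF (s : R) := nu * (1 - nu) * (expR s - expR (- s) - 2 * expR (nu * s)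
  + 2 * expR (- ((1 - nu) * s))).
have : 0 <= F s.
  apply: (@ge0_of_derive_ge0 F dF) s0 => [|x|x x0].
  - by rewrite /F oppr0 !mulr0 oppr0 expR0; ring.
  - by rewrite /F /dF; apply: is_derive_eq; rewrite /GRing.scale /=; ring.
  - rewrite /dF !mulr_ge0 //; first by lra.
    (* in terms of w and v the derivative factors as announced *)
    pose w := expR (x / 2); pose v := expR ((nu - 2^-1) * x).
    have w0 : 0 < w := expR_gt0 _.
    have w1 : 1 <= w by rewrite -expR0 ler_expR divr_ge0.
    have v1 : v <= 1 by rewrite -expR0 ler_expR mulr_le0_ge0 // subr_le0.
    have -> : expR x = w ^+ 2 by rewrite /w -expRM_natl -mulr_natl; congr expR; field.
    have -> : expR (- x) = w^-1 ^+ 2.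
      by rewrite /w -expRN -expRM_natl -mulr_natl; congr expR; field.
    have -> : expR (nu * x) = v * w by rewrite /w /v -expRD; congr expR; field.
    have -> : expR (- ((1 - nu) * x)) = v * w^-1.
      by rewrite /w /v -expRN -expRD; congr expR; field.
    rewrite (_ : _ + _ = (w - w^-1) * (w + w^-1 - 2 * v)); last by ring.
    have wV : w^-1 <= 1 by rewrite invf_le1.
    apply: mulr_ge0; first lra.
    have := expR_sum_ge2 (x / 2); rewrite expRN -/w; lra.
by rewrite /F; lra.
Qed.

Lemma powRE_expR t r : 0 < t -> t `^ r = expR (r * ln t).
Proof. by move=> t0; rewrite /powR gt_eqF. Qed.

Definition admissible nu t :=
  (0 <= nu <= 2^-1 /\ 1 <= t) \/ (2^-1 <= nu <= 1 /\ 0 < t <= 1).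

(** Replacing t by 1 / t and nu by 1 - nu exchanges the two ranges and leaves
the inequality [exp_mean_ineq] unchanged. *)
Lemma powR_upper nu t : admissible nu t ->
  t `^ nu <= 2^-1 * (1 - nu + nu * t) + 2^-1 * (1 - nu + nu * t^-1)^-1.
Proof.
move=> adm.
have [t0 nu0 nu1] : [/\ 0 < t, 0 <= nu & nu <= 1].
  by case: adm => -[/andP[? ?]] => [|/andP[? ?]]; split; lra.
have b0 : 0 < 1 - nu + nu * t^-1.
  have tV : 0 < t^-1 by rewrite invr_gt0.
  have [->|nup] := eqVneq nu 0; first by lra.
  have : 0 < nu * t^-1 by rewrite mulr_gt0 // lt_neqAle eq_sym nup.
  by lra.
rewrite -(ler_pM2l (ltr0Sn R 1)) mulrDr !mulrA mulfV // !mul1r.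
rewrite -(ler_pM2r b0) [leRHS]mulrDl mulVf ?gt_eqF //.
have key : 2 * (1 - nu) * expR (nu * ln t) + 2 * nu * expR (- ((1 - nu) * ln t)) <=
  (1 - nu) ^+ 2 + nu ^+ 2 + 1 + nu * (1 - nu) * (expR (ln t) + expR (- ln t)).
  case: adm => -[/andP[n1 n2]] => [t1|/andP[_ t1]].
    by apply: exp_mean_ineq; rewrite ?ln_ge0 // n1.
  have : 0 <= 1 - nu <= 2^-1 by apply/andP; split; lra.
  have : 0 <= - ln t by rewrite oppr_ge0 ln_le0.
  move=> h1 /(exp_mean_ineq h1); rewrite !opprK subKr !mulrN opprK; lra.
have e : expR (ln t) = t by rewrite lnK // posrE.
move: key; rewrite expRN e powRE_expR //.
have -> : expR (- ((1 - nu) * ln t)) = expR (nu * ln t) * t^-1.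
  by rewrite -[X in _ / X]e -expRN -expRD; congr expR; ring.
rewrite (_ : (1 - nu + nu * t) * _ = (1 - nu) ^+ 2 + nu * (1 - nu) * (t + t^-1)
  + nu ^+ 2 * (t * t^-1)); last by ring.
rewrite mulfV ?gt_eqF //; lra.
Qed.

(** The exponential is above its tangent:
t^nu / sqrt t = exp ((nu - 1/2) ln t) >= 1 + (nu - 1/2) ln t.  It remains to
compare ln t with sqrt t - 1 / sqrt t, which is [sinh_ge] at s = ln t / 2. *)
Lemma powR_lower nu t : admissible nu t ->
  t `^ (2^-1) + (nu - 2^-1) * (t - 1) <= t `^ nu.
Proof.
move=> adm.
have t0 : 0 < t.
  by case: adm => -[/andP[? ?]] => [|/andP[? ?]]; lra.
pose s := ln t / 2; pose w := expR s.
have w0 : 0 < w := expR_gt0 _.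
have tE : t = w ^+ 2.
  by rewrite /w -expRM_natl /s mulrC divfK ?pnatr_eq0 // lnK ?posrE.
have -> : t `^ (2^-1) = w by rewrite powRE_expR // /w /s mulrC.
have -> : t `^ nu = w * expR ((nu - 2^-1) * (2 * s)).
  by rewrite powRE_expR // /w /s -expRD; congr expR; field.
apply: le_trans (_ : w * (1 + (nu - 2^-1) * (2 * s)) <= _); last first.
  by rewrite ler_wpM2l ?(ltW w0) // expR_ge1Dx.
rewrite [leRHS]mulrDr mulr1 lerD2l.
have -> : t - 1 = w * (w - w^-1) by rewrite tE mulrBr mulfV ?gt_eqF // expr2.
rewrite mulrCA ler_wpM2l ?(ltW w0) //.
case: adm => -[/andP[n1 n2]] => [t1|/andP[_ t1]].
  rewrite -subr_ge0 -mulrBr mulr_le0 ?subr_le0 //.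
  by rewrite /w -expRN; apply: sinh_ge; rewrite divr_ge0 // ln_ge0.
rewrite ler_wpM2l ?subr_ge0 //.
have : 0 <= - s by rewrite /s -mulNr divr_ge0 // oppr_ge0 ln_le0.
by move/sinh_ge; rewrite opprK -/w expRN -/w; lra.
Qed.

End Scalar.

(** * Powers and inverses of positive invertible operators *)

Section Powers.
Context {R : realType} {H : hilbertType R}.
Implicit Types (A B S T : H -> H) (x y : H) (a b c M t e r s : R).

Lemma inv_opE A B : is_inverse A B -> inv_op A = B.
Proof.
move=> AB; have := xgetPex 0 (ex_intro (fun B => is_inverse A B) B AB).
rewrite -/(inv_op A) => -[_ AI IA]; have [_ AB1 BA1] := AB.
apply/funext => x; rewrite -[LHS]/(inv_op A (idfun x)) -AB1 /=.
exact: (congr1 (@^~ (B x)) IA).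
Qed.

Lemma calc_cst a A : bounded_op A -> calc (fun=> a) A (a%:C *: idfun).
Proof.
move=> bA; rewrite (_ : _ *: _ = horner_op a%:P A).
  by apply: calc_ext (calc_horner _ bA) => t _; rewrite hornerC.
by apply/funext => x; rewrite horner_opC.
Qed.

Lemma calc_self A : bounded_op A -> calc idfun A A.
Proof.
move=> bA; rewrite [X in calc _ _ X](_ : A = horner_op 'X A).
  by apply: calc_ext (calc_horner _ bA) => t _; rewrite hornerX.
by apply/funext => x; rewrite horner_opX.
Qed.

(** For c > 0, the quantitative form of being positive and invertible. *)
Definition coercive c A := self_adjoint A /\ forall x, c * rnorm x ^+ 2 <= rdot x (A x).

Lemma spectrum_coercive c A t : 0 < c -> coercive c A -> spectrum A t%:C -> 0 < t.
Proof.
by move=> c0 [sA cA] At; apply: lt_le_trans c0 _; exact: spectrum_ge cA At.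
Qed.

(** The spectrum of A lies in an interval that starts at c > 0, and f need only be
Lipschitz there. *)
Lemma calc_lipschitz f c A : 0 < c -> coercive c A ->
  (forall b, lipschitz_itv c b f) -> calc f A (cfc f A).
Proof.
move=> c0 [sA cA] lf; have [M M0 AM] := bounded_opP sA.1.
pose b := Num.max M (c + 1).
have cb : c < b by rewrite lt_max ltrDl ltr01 orbT.
apply: calc_of_cfc; first exact: sA.1.
apply: xgetPex; apply: cfc_exists => // e e0.
have [p pf] := lipschitz_poly_approx cb (lf b) e0.
exists p => t At; apply: pf; rewrite (spectrum_ge sA cA At) /=.
apply: spectrum_le At => // x; apply: le_trans (rdot_le _ _) _.
rewrite expr2 mulrCA ler_wpM2l ?rnorm_ge0 //; apply: le_trans (AM x) _.
by rewrite ler_wpM2r ?rnorm_ge0 // le_max lexx.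
Qed.

Section Pow.
Context (c : R) (A : H -> H) (c0 : 0 < c) (cA : coercive c A).
Let sA : self_adjoint A := cA.1.

Lemma calc_pow r : calc (fun t => t `^ r) A (pow_op A r).
Proof. by apply: calc_lipschitz c0 cA _ => b; exact: lipschitz_powR. Qed.

Lemma self_adjoint_pow r : self_adjoint (pow_op A r).
Proof. exact: calc_self_adjoint (calc_pow r). Qed.

Lemma pow_op1 : pow_op A 1 = A.
Proof.
apply: (calc_unique sA (calc_pow 1)); apply: calc_ext (calc_self sA.1) => t At.
by rewrite powRr1 // ltW // (spectrum_coercive c0 cA).
Qed.

Lemma pow_op0 : pow_op A 0 = idfun.
Proof.
apply: (calc_unique sA (calc_pow 0)).
rewrite [X in calc _ _ X](_ : idfun = 1%:C *: (idfun : H -> H)).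
  by apply: calc_ext (calc_cst 1 sA.1) => t At; rewrite powRr0.
by rewrite rmorph1 scale1r.
Qed.

Lemma pow_opD r s x : pow_op A r (pow_op A s x) = pow_op A (r + s) x.
Proof.
rewrite -[LHS]/((pow_op A r \o pow_op A s) x); congr (_ x).
apply: (calc_unique sA (calcM sA (calc_pow r) (calc_pow s))).
apply: calc_ext (calc_pow (r + s)) => t At.
by rewrite powRD // (gt_eqF (spectrum_coercive c0 cA At)) implybT.
Qed.

Lemma pow_opK x : pow_op A 2^-1 (pow_op A (- 2^-1) x) = x.
Proof. by rewrite pow_opD subrr pow_op0. Qed.

Lemma pow_opVK x : pow_op A (- 2^-1) (pow_op A 2^-1 x) = x.
Proof. by rewrite pow_opD addNr pow_op0. Qed.

Lemma pow_op_half x : pow_op A 2^-1 (pow_op A 2^-1 x) = A x.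
Proof. by rewrite pow_opD (_ : 2^-1 + 2^-1 = 1) ?pow_op1 //; field. Qed.

Lemma inv_op_pow : inv_op A = pow_op A (-1).
Proof.
apply: inv_opE; split; first exact: (calc_pow _).1.
  apply/funext => x; rewrite -[LHS]/(A (pow_op A (-1) x)) -{1}pow_op1.
  by rewrite pow_opD subrr pow_op0.
apply/funext => x; rewrite -[LHS]/(pow_op A (-1) (A x)) -{2}pow_op1.
by rewrite pow_opD addNr pow_op0.
Qed.

(** The square root of A is bounded, hence its inverse is bounded below. *)
Lemma pow_op_coercive B d : 0 < d -> coercive d B ->
  exists2 k, 0 < k & coercive k (pow_op A (- 2^-1) \o B \o pow_op A (- 2^-1)).
Proof.
move=> d0 [sB cB]; have [K K0 RK] := bounded_opP (self_adjoint_pow 2^-1).1.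
exists (d / K ^+ 2); first by rewrite divr_gt0 // exprn_gt0.
split; first exact: self_adjoint_congr sB (self_adjoint_pow _).
move=> x /=; rewrite -self_adjoint_rdot; last exact: self_adjoint_pow.
apply: le_trans (cB _); rewrite -mulrA ler_wpM2l ?(ltW d0) //.
rewrite mulrC ler_pdivrMr ?exprn_gt0 // -exprMn ler_pXn2r ?nnegrE ?rnorm_ge0 //.
  by rewrite -{1}(pow_opK x) mulrC; exact: RK.
by rewrite mulr_ge0 ?rnorm_ge0 // ltW.
Qed.

End Pow.
End Powers.

(** * The inequalities for the geometric mean *)

Section GeometricMean.
Context {R : realType} {H : hilbertType R}.
Context (A B : H -> H) (a b nu : R).
Context (a0 : 0 < a) (b0 : 0 < b) (cA : coercive a A) (cB : coercive b B).

Let Q := pow_op A 2^-1.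
Let Qi := pow_op A (- 2^-1).
Let C := Qi \o B \o Qi.

Context (nu01 : 0 <= nu <= 1).
Context (adm : forall t, spectrum C t%:C -> admissible nu t).

Let sQ : self_adjoint Q := self_adjoint_pow a0 cA _.
Let sQi : self_adjoint Qi := self_adjoint_pow a0 cA _.
Let sC : self_adjoint C := self_adjoint_congr cB.1 sQi.

(** The form of Q S Q at x is the form of S at Q x. *)
Lemma congr_le S T : self_adjoint S -> self_adjoint T ->
  (forall x, rdot x (S x) <= rdot x (T x)) -> le_op (Q \o S \o Q) (Q \o T \o Q).
Proof.
move=> sS sT ST; apply/le_opE; split=> [||x]; [exact: self_adjoint_congr..|].
by rewrite /= -!(self_adjoint_rdot _ _ sQ).
Qed.

Lemma normalizedE x : B x = Q (C (Q x)).
Proof. by rewrite /C /= /Q /Qi (pow_opK a0 cA) (pow_opVK a0 cA). Qed.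

Lemma gmean_lower :
  le_op (gmean 2^-1 A B + (nu - 2^-1)%:C *: (B - A)) (gmean nu A B).
Proof.
have [k k0 cC] := pow_op_coercive a0 cA b0 cB; rewrite -/Qi -/C in cC.
pose L := pow_op C 2^-1 + (nu - 2^-1)%:C *: (C + (-1)%:C *: idfun).
have cL := calcD (calc_pow k0 cC 2^-1) (calcZ (nu - 2^-1)
  (calcD (calc_self sC.1) (calc_cst (-1) sC.1))).
rewrite -/L in cL.
rewrite (_ : _ + _ = Q \o L \o Q); last first.
  apply/funext => x; rewrite /= /L -/(gmean _ _ _ x).
  rewrite -[RHS]/(Q (pow_op C 2^-1 (Q x) +
    (nu - 2^-1)%:C *: (C (Q x) + (-1)%:C *: Q x))).
  rewrite (opD sQ.1) (opZ sQ.1) (opD sQ.1) (opZ sQ.1) -normalizedE.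
  by rewrite /Q (pow_op_half a0 cA) rmorphN1 scaleN1r.
apply: congr_le; [exact: calc_self_adjoint cL|exact: self_adjoint_pow cC _|].
apply: (calc_le sC cL (calc_pow k0 cC nu)) => t /adm; exact: powR_lower.
Qed.

Lemma gmean_upper :
  le_op (gmean nu A B)
    (2^-1 *: ((1 - nu)%:C *: A + nu%:C *: B) +
     2^-1 *: inv_op ((1 - nu)%:C *: inv_op A + nu%:C *: inv_op B)).
Proof.
have [k k0 cC] := pow_op_coercive a0 cA b0 cB; rewrite -/Qi -/C in cC.
have /andP[n0 n1] := nu01; have bC := sC.1.
pose g t := (1 - nu) + nu * t `^ (-1).
(* D = g(C) is (1-nu) + nu C^-1, and V will be its inverse *)
pose D := (1 - nu)%:C *: (idfun : H -> H) + nu%:C *: pow_op C (-1).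
have cD : calc g C D := calcD (calc_cst (1 - nu) bC) (calcZ nu (calc_pow k0 cC (-1))).
(* u^-1 is at most 1 and at most t^-1, hence at most their weighted mean *)
have g_ge t u : 0 < t <= u -> 1 <= u -> u^-1 <= g t.
  move=> /andP[t0 tu] u1; rewrite /g (powR_inv1 (ltW t0)).
  have h1 : u^-1 <= t^-1 by rewrite lef_pV2 ?posrE // (lt_le_trans t0).
  have h2 : u^-1 <= 1 by rewrite invf_le1 // (lt_le_trans ltr01).
  have := ler_wpM2l n0 h1; have : (1 - nu) * u^-1 <= (1 - nu) * 1.
    by rewrite ler_wpM2l // subr_ge0.
  lra.
have g0 t : spectrum C t%:C -> 0 < g t.
  move=> /(spectrum_coercive k0 cC) t0; have u0 : 0 < Num.max t 1 by rewrite lt_max t0.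
  apply: lt_le_trans (g_ge t (Num.max t 1) _ _); first by rewrite invr_gt0.
    by rewrite t0 le_max lexx.
  by rewrite le_max lexx orbT.
pose V := cfc (fun t => (g t)^-1) C.
have cV : calc (fun t => (g t)^-1) C V.
  apply: (calc_lipschitz k0 cC) => d; pose u := `|d| + 1.
  have u1 : 1 <= u by rewrite lerDr.
  apply: (@lipschitz_inv _ _ _ _ u^-1); first by rewrite invr_gt0 (lt_le_trans ltr01).
    move=> t /andP[kt td]; apply: g_ge => //; rewrite (lt_le_trans k0 kt) /=.
    by apply: le_trans td _; apply: le_trans (ler_norm _) _; rewrite lerDl.
  by apply: lipschitz_affine; exact: lipschitz_powR.
have c1 : calc (fun=> 1) C (idfun : H -> H).
  by have := calc_cst 1 bC; rewrite rmorph1 scale1r.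
have DV : D \o V = idfun.
  apply: (calc_unique sC (calcM sC cD cV)); apply: calc_ext c1 => t /g0 gt.
  by rewrite mulfV // gt_eqF.
have VD : V \o D = idfun.
  apply: (calc_unique sC (calcM sC cV cD)); apply: calc_ext c1 => t /g0 gt.
  by rewrite mulVf // gt_eqF.
have invA x : inv_op A x = Qi (Qi x).
  by rewrite (inv_op_pow a0 cA) /Qi (pow_opD a0 cA); congr (pow_op A _ x); field.
have QQi x : Q (Qi x) = x by exact: pow_opK a0 cA _.
have QiQ x : Qi (Q x) = x by exact: pow_opVK a0 cA _.
have CCi x : C (pow_op C (-1) x) = x.
  rewrite -[X in X (pow_op C _ x)](pow_op1 k0 cC) (pow_opD k0 cC) subrr.
  by rewrite (pow_op0 k0 cC).
have CiC x : pow_op C (-1) (C x) = x.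
  rewrite -[X in pow_op C _ (X x)](pow_op1 k0 cC) (pow_opD k0 cC) addNr.
  by rewrite (pow_op0 k0 cC).
have invB : inv_op B = Qi \o pow_op C (-1) \o Qi.
  apply: inv_opE; split.
  - apply: bounded_comp sQi.1; apply: bounded_comp sQi.1 _.
    by have [] := calc_pow k0 cC (-1).
  - by apply/funext => x /=; rewrite normalizedE QQi CCi QQi.
  - by apply/funext => x /=; rewrite normalizedE QiQ CiC QiQ.
have invE : inv_op ((1 - nu)%:C *: inv_op A + nu%:C *: inv_op B) = Q \o V \o Q.
  rewrite (_ : _ + _ = Qi \o D \o Qi); last first.
    apply/funext => x; rewrite invB.
    rewrite -[LHS]/((1 - nu)%:C *: inv_op A x +
      nu%:C *: Qi (pow_op C (-1) (Qi x))) invA.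
    rewrite -[RHS]/(Qi ((1 - nu)%:C *: Qi x + nu%:C *: pow_op C (-1) (Qi x))).
    by rewrite (opD sQi.1) !(opZ sQi.1).
  apply: inv_opE; split.
  - by apply: bounded_comp sQ.1; apply: bounded_comp sQ.1 _; exact: cV.1.
  - apply/funext => x; rewrite -[LHS]/(Qi (D (Qi (Q (V (Q x)))))) QiQ.
    by rewrite -[D _]/((D \o V) (Q x)) DV QiQ.
  - apply/funext => x; rewrite -[LHS]/(Q (V (Q (Qi (D (Qi x)))))) QQi.
    by rewrite -[V _]/((V \o D) (Qi x)) VD QQi.
have half : (2^-1 : R[i]) = (2^-1 : R)%:C by rewrite fmorphV rmorph_nat.
rewrite invE half.
pose U := (2^-1)%:C *: ((1 - nu)%:C *: (idfun : H -> H) + nu%:C *: C) + (2^-1)%:C *: V.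
have cU := calcD (calcZ 2^-1 (calcD (calc_cst (1 - nu) bC) (calcZ nu (calc_self bC))))
  (calcZ 2^-1 cV).
rewrite -/U in cU.
rewrite [X in le_op _ X](_ : _ = Q \o U \o Q); last first.
  apply/funext => x.
  rewrite -[LHS]/((2^-1)%:C *: ((1 - nu)%:C *: A x + nu%:C *: B x) +
    (2^-1)%:C *: Q (V (Q x))).
  rewrite -[RHS]/(Q ((2^-1)%:C *: ((1 - nu)%:C *: Q x + nu%:C *: C (Q x)) +
    (2^-1)%:C *: V (Q x))).
  rewrite !(opD sQ.1, opZ sQ.1) -normalizedE.
  by rewrite /Q (pow_op_half a0 cA).
apply: congr_le; [exact: self_adjoint_pow k0 cC _|exact: calc_self_adjoint cU|].
apply: (calc_le sC (calc_pow k0 cC nu) cU) => t Ct /=.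
have t0 := spectrum_coercive k0 cC Ct.
rewrite /g powR_inv1 ?(ltW t0) //; exact/powR_upper/adm.
Qed.

End GeometricMean.

Theorem theorem2p1 (R : realType) (H : hilbertType R) (A B : H -> H) (nu : R)
    (saA : self_adjoint A) (saB : self_adjoint B)
    (hyp : (0 <= nu <= 2^-1 /\ pos_invertible A /\ le_op A B) \/
           (2^-1 <= nu <= 1 /\ pos_invertible B /\ le_op B A)) :
  le_op (gmean 2^-1 A B + (nu - 2^-1)%:C *: (B - A)) (gmean nu A B) /\
  le_op (gmean nu A B)
    (2^-1 *: ((1 - nu)%:C *: A + nu%:C *: B) +
     2^-1 *: inv_op ((1 - nu)%:C *: inv_op A + nu%:C *: inv_op B)).
Proof.
have coerc (T : H -> H) : pos_invertible T -> exists2 c, 0 < c & coercive c T.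
  move=> [/positive_opE[sT T0] iT].
  by have [c c0 cT] := coercive_of_invertible sT T0 iT; exists c.
have mono (S T : H -> H) c : coercive c S -> le_op S T -> coercive c T.
  move=> [_ cS] /le_opE[_ sT ST]; split=> // x; exact: le_trans (cS x) (ST x).
have [c c0 [cA cB]] : exists2 c, 0 < c & coercive c A /\ coercive c B.
  case: hyp => -[_ [/coerc[c c0 cT] le]]; exists c => //; split=> //; exact: mono le.
have nu01 : 0 <= nu <= 1 by case: hyp => -[/andP[? ?] _]; apply/andP; split; lra.
pose Qi := pow_op A (- 2^-1).
have sQi : self_adjoint Qi := self_adjoint_pow c0 cA _.
have [k k0 cC] := pow_op_coercive c0 cA c0 cB.
(* so A <= B says that C = Qi B Qi is at least 1, and B <= A that it is at most 1 *)
have Qi1 x : rdot (Qi x) (A (Qi x)) = rnorm x ^+ 2.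
  rewrite -(pow_op_half c0 cA) -self_adjoint_rdot; last exact: self_adjoint_pow c0 cA _.
  by rewrite (pow_opK c0 cA) rdotxx.
have adm t : spectrum (Qi \o B \o Qi) t%:C -> admissible nu t.
  move=> Ct; have t0 := spectrum_coercive k0 cC Ct.
  case: hyp => -[nuP [_ /le_opE[_ _ le]]]; [left|right]; split=> //.
    apply: spectrum_ge cC.1 _ Ct => x.
    by rewrite /= -(self_adjoint_rdot _ _ sQi) mul1r -Qi1.
  rewrite t0 /=; apply: spectrum_le cC.1 _ Ct => x.
  by rewrite /= -(self_adjoint_rdot _ _ sQi) mul1r -Qi1.
split; [exact: (gmean_lower c0 c0 cA cB adm)|exact: (gmean_upper c0 c0 cA cB nu01 adm)].
Qed.
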